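(* Let $n\in\mathbb N$, let $A$ be an $n\times n$ complex matrix all of whose eigenvalues have positive real parts, and let $G:\mathbb C^n\to\mathbb C^n$, $G\sim\sum_{m\ge2}G_m$, $G_m(x)=\mathcal G_m(x,\dots,x)$, be as in the context. Let $f:(0,\infty)\to\mathbb C^n$ be a function that is continuous on $[T_f,\infty)$ for some $T_f\ge 0$. Let $(\mu_k)_{k=1}^\infty$ be a divergent, strictly increasing sequence of positive numbers such that the set $\mathcal S=\{\mu_k:k\in\mathbb N\}$ satisfies $x+y\in\mathcal S$ and $x+1\in\mathcal S$ for all $x,y\in\mathcal S$, and let $(n_k)_{k=1}^\infty$ be an increasing sequence in $\mathbb Z_+$ (meaning $n_k\le n_{k+1}$). Assume that $f$ admits the asymptotic expansion, in the power sense of the context, $$f(t)\sim\sum_{k=1}^\infty f_k(t),\qquad f_k\in\mathscr F_0(n_k,-\mu_k,\mathbb C^n)\text{ for }k\in\mathbb N.$$ Let $T_0\ge 0$ and let $y\in C^1((T_0,\infty),\mathbb C^n)$ be a solution of $y'=-Ay+G(y)+f(t)$ on $(T_0,\infty)$ with $y(t)\to0$ as $t\to\infty$. Then there exist functions $y_k\in\mathscr F_0(n_k,-\mu_k,\mathbb C^n)$, $k\in\mathbb N$, such that $y$ admits the asymptotic expansion, in the same power sense, $$y(t)\sim\sum_{k=1}^\infty y_k(t).$$ More specifically, assume that for all $k\in\mathbb N$, $f_k(t)=p_k(\widehat{\mathcal L}_{n_k}(t))$ with $p_k\in\mathscr P_0(n_k,-\mu_k,\mathbb C^n)$. Then the functions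 $y_k$ can be constructed recursively as follows: for each $k\in\mathbb N$, $y_k(t)=q_k(\widehat{\mathcal L}_{n_k}(t))$, where $$q_k=\mathcal Z_A\Big(\sum_{m\ge2}\ \sum_{\mu_{j_1}+\mu_{j_2}+\cdots+\mu_{j_m}=\mu_k}\mathcal G_m(q_{j_1},q_{j_2},\ldots,q_{j_m})+p_k-\chi_k\Big),$$ with $$\chi_k=\begin{cases}\mathcal R q_\lambda&\text{if there exists }\lambda\le k-1\text{ such that }\mu_\lambda+1=\mu_k,\\ 0&\text{otherwise.}\end{cases}$$
   Context: $\mathbb N=\{1,2,\dots\}$, $\mathbb Z_+=\mathbb N\cup\{0\}$; $|\cdot|$ is the Euclidean norm; $u(t)=\mathcal O(h(t))$ means that there are $T,C>0$ with $|u(t)|\le Ch(t)$ for all $t\ge T$. Assumption on $G$: $G:\mathbb C^n\to\mathbb C^n$ is locally Lipschitz, and there exist functions $G_m:\mathbb C^n\to\mathbb C^n$, $m\ge 2$, each a homogeneous polynomial of degree $m$, such that for any $N\ge2$ there exists $\delta>0$ with $|G(x)-\sum_{m=2}^N G_m(x)|=\mathcal O(|x|^{N+\delta})$ as $x\to0$. For each $m\ge2$, $\mathcal G_m$ is an $m$-linear mapping (over $\mathbb C$) from $(\mathbb C^n)^m$ to $\mathbb C^n$ with $G_m(x)=\mathcal G_m(x,x,\ldots,x)$. Iterated functions: $E_0(t)=t$, $E_{m+1}(t)=e^{E_m(t)}$; $L_{-1}(t)=e^t$, $L_0(t)=t$, $L_{m+1}(t)=\ln L_m(t)$ for $m\in\mathbb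 Z_+$, $t>E_m(0)$. For $k\in\mathbb Z_+$, $\widehat{\mathcal L}_k(t)=(L_{-1}(t),L_0(t),L_1(t),\ldots,L_k(t))=(e^t,t,\ln t,\ldots,L_k(t))$, which lies in $(0,\infty)^{k+2}$ for $t>E_k(0)$. Power functions: for $t>0$, $c\in\mathbb C$, $t^c=\exp(c\ln t)$. For $z=(z_{-1},z_0,\ldots,z_k)\in(0,\infty)^{k+2}$ and $\alpha=(\alpha_{-1},\alpha_0,\ldots,\alpha_k)\in\mathbb C^{k+2}$, $z^\alpha=\prod_{j=-1}^kz_j^{\alpha_j}$. Classes: for integers $k\ge m\ge-1$ and $\mu\in\mathbb R$, $\mathcal E(m,k,\mu)$ is the set of $\alpha\in\mathbb C^{k+2}$ with $\operatorname{Re}\alpha_j=0$ for $-1\le j<m$ and $\operatorname{Re}\alpha_m=\mu$. For a complex linear space $X$, $\mathscr P(k,X)$ is the set of functions $p(z)=\sum_{\alpha\in S}z^\alpha\xi_\alpha$, $z\in(0,\infty)^{k+2}$, with $S\subset\mathbb C^{k+2}$ finite and $\xi_\alpha\in X$; $\mathscr P_m(k,\mu,X)$ is the set of such functions with $S\subset\mathcal E(m,k,\mu)$; and $\mathscr F_m(k,\mu,X)=\{p\circ\widehat{\mathcal L}_k:p\in\mathscr P_m(k,\mu,X)\}$ (functions on $(E_k(0),\infty)$). For $k<k'$, a function in $\mathscr P(k,X)$ is regarded as an element of $\mathscr P(k',X)$ not depending on the extra variables (zero exponents). Operators: for $p(z)=\sum_{\alpha\in S}z^\alpha\xi_\alpha\in\mathscr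 P(k,\mathbb C^n)$, $(\mathcal M_jp)(z)=\sum_{\alpha\in S}\alpha_jz^\alpha\xi_\alpha$ for $-1\le j\le k$; for $k\ge0$, $(\mathcal Rp)(z)=\sum_{j=0}^kz_0^{-1}z_1^{-1}\cdots z_j^{-1}(\mathcal M_jp)(z)$; for $p\in\mathscr P_{-1}(k,0,\mathbb C^n)$, $(\mathcal Z_Ap)(z)=\sum_{\alpha\in S}z^\alpha(A+\alpha_{-1}I_n)^{-1}\xi_\alpha$ (here $\operatorname{Re}\alpha_{-1}=0$, so the inverses exist). One has $\mathscr P_m(k,\mu,\mathbb C^n)\subset\mathscr P_{-1}(k,0,\mathbb C^n)$ for $m\ge0$, so $\mathcal Z_A$ is defined there. Asymptotic expansion (power sense): for $g$ from $(T,\infty)$ to a complex normed space $X$, a divergent, strictly increasing sequence $(\gamma_k)$ of positive numbers and integers $n_k\in\mathbb Z_+$, $g(t)\sim\sum_{k=1}^\infty g_k(t)$ with $g_k\in\mathscr F_0(n_k,-\gamma_k,X)$ means: for each $N\in\mathbb N$ there is $\mu>\gamma_N$ with $\|g(t)-\sum_{k=1}^Ng_k(t)\|_X=\mathcal O(t^{-\mu})$. In the double sum, $m$ ranges over integers $\ge2$ and $j_1,\ldots,j_m$ over $\mathbb N$ subject to the stated condition; the sum is finite, involves only indices $j_\ell\le k-1$, and is zero if no such indices exist. The index $\lambda$ in the definition of $\chi_k$ is a positive integer, unique if it exists. *)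

(* Defs.v *)
From HB Require Import structures.
From mathcomp Require Import all_boot all_order all_algebra.
From mathcomp Require Import finmap.
From mathcomp Require Import all_classical all_reals all_analysis.
From mathcomp Require Import complex ring.
From mathcomp Require mpoly.

Set Implicit Arguments.
Unset Strict Implicit.
Unset Printing Implicit Defensive.

Import Order.TTheory GRing.Theory Num.Theory.
Import numFieldNormedType.Exports.

Local Open Scope classical_set_scope.
Local Open Scope complex_scope.
Local Open Scope ring_scope.

Section Space.
Variables (R : realType) (n : nat).
Local Notation C := R[i].
Local Notation X := 'cV[C]_n.

Definition enorm (x : X) : R :=
  Num.sqrt (\sum_(i < n) (complex.Re (x i 0) ^+ 2 + complex.Im (x i 0) ^+ 2)).

(* The library puts no topology on R[i]; limits, continuity and derivatives of
   C^n-valued functions are taken with respect to the Euclidean norm. *)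
Definition ecvg (T : Type) (F : set_system T) (u : T -> X) (l : X) : Prop :=
  enorm (u x - l) @[x --> F] --> (0 : R).

Definition econtinuous_on (D : set R) (u : R -> X) : Prop :=
  forall t, D t -> ecvg (within D (nbhs t)) u (u t).

Definition is_ederive (u : R -> X) (t : R) (d : X) : Prop :=
  ecvg (0 : R)^' (fun h => (h^-1)%:C *: (u (t + h) - u t)) d.

Definition C1_on (D : set R) (u : R -> X) : Prop :=
  exists du : R -> X,
    (forall t, D t -> is_ederive u t (du t)) /\ econtinuous_on D du.

Definition bigO_pinfty (u : R -> X) (h : R -> R) : Prop :=
  exists T K : R, [/\ 0 < T, 0 < K &
    forall t, T <= t -> enorm (u t) <= K * h t].

Definition locally_lipschitz (G : X -> X) : Prop :=
  forall x0 : X, exists r K : R, 0 < r /\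
    forall x y, enorm (x - x0) < r -> enorm (y - x0) < r ->
      enorm (G x - G y) <= K * enorm (x - y).

Definition homogeneous_polynomial (m : nat) (g : X -> X) : Prop :=
  forall i : 'I_n, exists P : mpoly.mpoly n C,
    (forall e, mpoly.mcoeff e P != 0 -> mpoly.mdeg e = m) /\
    forall x : X, g x i 0 = mpoly.meval (fun j => x j 0) P.

Definition upd (m : nat) (v : {ffun 'I_m -> X}) (i : 'I_m) (x : X) :
    {ffun 'I_m -> X} :=
  [ffun l => if l == i then x else v l].

Definition multilinear (m : nat) (g : {ffun 'I_m -> X} -> X) : Prop :=
  forall (v : {ffun 'I_m -> X}) (i : 'I_m) (a : C) (x y : X),
    g (upd v i (a *: x + y)) = a *: g (upd v i x) + g (upd v i y).

Definition expands_at0 (G : X -> X) (G_ : nat -> X -> X) : Prop :=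
  forall N, (2 <= N)%N -> exists delta : R, 0 < delta /\
    exists r K : R, [/\ 0 < r, 0 < K & forall x, enorm x < r ->
      enorm (G x - \sum_(2 <= m < N.+1) G_ m x)
        <= K * enorm x `^ (N%:R + delta)].

End Space.

Section Powers.
Variable R : realType.
Local Notation C := R[i].

Definition iterexp (m : nat) (t : R) : R := iter m expR t.

(* Coordinates indexed by -1, 0, ..., k are stored in 'I_k.+2, the coordinate
   of index j at position j + 1. *)
Definition lvl (k : nat) (j : 'I_k.+2) : int := (j : nat)%:Z - 1.

Definition Lhat (k : nat) (t : R) (j : 'I_k.+2) : R :=
  if val j is j'.+1 then iter j' (@ln R) t else expR t.

Definition cexp (z : C) : C :=
  (expR (complex.Re z))%:C * (cos (complex.Im z) +i* sin (complex.Im z)).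

Definition cpow (t : R) (c : C) : C := cexp (c * (ln t)%:C).

Definition zpow (k : nat) (z : 'I_k.+2 -> R) (a : 'rV[C]_k.+2) : C :=
  \prod_(j < k.+2) cpow (z j) (a 0 j).

Definition orthant (k : nat) : set ('I_k.+2 -> R) :=
  [set z : 'I_k.+2 -> R | forall j, 0 < z j].

Definition calE (m : int) (k : nat) (mu : R) : set 'rV[C]_k.+2 :=
  [set a : 'rV[C]_k.+2 |
    (forall j, lvl j < m -> complex.Re (a 0 j) = 0) /\
    (forall j, lvl j = m -> complex.Re (a 0 j) = mu)].

Lemma cexpD (x y : C) : cexp (x + y) = cexp x * cexp y.
Proof.
case: x => a b; case: y => c d.
rewrite /cexp /= expRD cosD sinD /real_complex_def /=.
by apply/eqP; rewrite eq_complex /=; apply/andP; split; apply/eqP; ring.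
Qed.

Lemma cexp0 : cexp 0 = 1.
Proof. by rewrite /cexp /= expR0 cos0 sin0 mul1r. Qed.

Lemma cexp_neq0 (x : C) : cexp x != 0.
Proof.
apply/eqP => h; have := cexpD x (- x).
by rewrite subrr cexp0 h mul0r => /eqP; rewrite oner_eq0.
Qed.

Lemma cpowM (r t : R) (c : C) :
  0 < r -> 0 < t -> cpow (r * t) c = cpow r c * cpow t c.
Proof. by move=> r0 t0; rewrite /cpow lnM// rmorphD mulrDr cexpD. Qed.

Lemma cexp_sep (w : C) : w != 0 -> exists u : R, cexp (w * u%:C) != 1.
Proof.
case: w => a b; rewrite eq_complex /= negb_and => /orP h.
have [a0|a0] := eqVneq a 0.
  have b0 : b != 0 by case: h => //; rewrite a0 eqxx.
  exists (pi / b); apply/eqP => /(congr1 (@complex.Re R)).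
  rewrite /cexp /= a0 !(oppr0, mul0r, mulr0, subr0, add0r, addr0) expR0.
  rewrite mulrCA divff// mulr1 cospi mul1r => /eqP.
  by rewrite eq_sym -subr_eq0 opprK (_ : 1 + 1 = 2%:R :> R)// pnatr_eq0.
exists 1; apply/eqP => h1.
have hR := congr1 (@complex.Re R) h1; have hI := congr1 (@complex.Im R) h1.
move: hR hI; rewrite /cexp /= !(oppr0, mul0r, mulr0, mulr1, subr0, add0r, addr0).
move=> hR hI; have : expR a ^+ 2 = 1.
  rewrite -[LHS]mulr1 -(cos2Dsin2 b) mulrDr -!exprMn hR hI.
  by rewrite expr1n expr0n cos2Dsin2 addr0.
move=> /eqP; rewrite sqrf_eq1 => /orP[/eqP e|/eqP e].
  by move/negP: a0; apply; rewrite -(inj_eq (@expR_inj R)) expR0 e.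
by have := expR_gt0 a; rewrite e oppr_gt0 ltr10.
Qed.

Lemma cpow_sep (c d : C) : c != d -> exists r, 0 < r /\ cpow r c != cpow r d.
Proof.
rewrite -subr_eq0 => /cexp_sep[u hu]; exists (expR u); split.
  exact: expR_gt0.
rewrite /cpow expRK; apply: contra hu => /eqP h.
by rewrite mulrBl cexpD h -cexpD subrr cexp0.
Qed.

Lemma zpow_neq0 k (z : 'I_k.+2 -> R) a : zpow z a != 0.
Proof. by apply/prodf_neq0 => j _; exact: cexp_neq0. Qed.

Lemma zpow_scale k (z : 'I_k.+2 -> R) a (j : 'I_k.+2) (r : R) :
  orthant z -> 0 < r ->
  zpow (fun i => if i == j then r * z i else z i) a
  = cpow r (a 0 j) * zpow z a.
Proof.
move=> z0 r0; rewrite /zpow (bigD1 j)//= [in RHS](bigD1 j)//= eqxx.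
rewrite cpowM// -mulrA; congr (_ * (_ * _)).
by apply: eq_bigr => i /negPf ->.
Qed.

End Powers.

Section Classes.
Variables (R : realType) (X : lmodType R[i]).
Local Notation C := R[i].

(* Functions on the open orthant; values elsewhere are irrelevant. *)
Definition gfun (k : nat) := ('I_k.+2 -> R) -> X.

Definition terms (k : nat) := ({fset 'rV[C]_k.+2} * ('rV[C]_k.+2 -> X))%type.

Definition represents (k : nat) (c : terms k) (p : gfun k) : Prop :=
  forall z, orthant z -> p z = \sum_(a <- c.1) zpow z a *: c.2 a.

Definition scrP_m (m : int) (k : nat) (mu : R) : set (gfun k) :=
  [set p | exists c : terms k,
     (forall a, a \in c.1 -> calE m mu a) /\ represents c p].

Definition scrF_m (m : int) (k : nat) (mu : R) : set (R -> X) :=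
  [set f | exists p : gfun k, scrP_m m mu p /\
     forall t, iterexp k 0 < t -> f t = p (@Lhat R k t)].

Definition widen_gfun (k k' : nat) (p : gfun k) : gfun k' :=
  fun z => p (fun j => z (inord j)).

Definition terms_of (k : nat) (p : gfun k) : terms k :=
  if pselect (exists c : terms k, represents c p) is left h then projT1 (cid h)
  else (fset0, fun=> 0).

(* z^a xi |-> z^a (phi a xi) term by term; it does not depend on the chosen
   representation when each phi a is additive (termwiseE below). *)
Definition termwise (k : nat) (phi : 'rV[C]_k.+2 -> X -> X) (p : gfun k) :
    gfun k :=
  fun z => \sum_(a <- (terms_of p).1) zpow z a *: phi a ((terms_of p).2 a).

Definition opM (k : nat) (j : 'I_k.+2) (p : gfun k) : gfun k :=
  termwise (fun a xi => a 0 j *: xi) p.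

Definition opR (k : nat) (p : gfun k) : gfun k :=
  fun z => \sum_(j < k.+2 | (0 <= lvl j)%R)
    (\prod_(i < k.+2 | (0 <= lvl i <= lvl j)%R) (z i)^-1)%:C *: opM j p z.

Lemma zpow_free (k : nat) (s : seq 'rV[C]_k.+2) (xi : 'rV[C]_k.+2 -> X) :
  uniq s -> (forall z, orthant z -> \sum_(a <- s) zpow z a *: xi a = 0) ->
  forall a, a \in s -> xi a = 0.
Proof.
elim: s xi => // b s IH xi /andP[bs us] h.
have hs (a : 'rV[C]_k.+2) : a \in s -> xi a = 0.
  move=> ains; have [j ab] : exists j, a 0 j != b 0 j.
    apply: contrapT => /forallNP nj; move/negP: bs; apply.
    suff -> : b = a by [].
    by apply/rowP => j; have /negP := nj j; rewrite negbK => /eqP ->.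
  have [r [r0 rab]] := cpow_sep ab.
  pose xi' (a : 'rV[C]_k.+2) := (cpow r (a 0 j) - cpow r (b 0 j)) *: xi a.
  have /eqP : xi' a = 0.
    apply: (IH xi') => // z z0.
    have z0' : orthant (fun i => if i == j then r * z i else z i).
      by move=> i /=; case: ifP => _; rewrite ?mulr_gt0.
    have h1 := h _ z0'; have h2 := h _ z0.
    have : \sum_(a0 <- b :: s)
        (cpow r (a0 0 j) - cpow r (b 0 j)) *: (zpow z a0 *: xi a0) = 0.
      under eq_bigr do rewrite scalerBl.
      rewrite sumrB -scaler_sumr h2 scaler0 subr0 -[RHS]h1.
      by apply: eq_bigr => i _; rewrite scalerA zpow_scale.
    rewrite big_cons subrr scale0r add0r => h3; rewrite -[RHS]h3.
    by apply: eq_bigr => i _; rewrite /xi' !scalerA mulrC.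
  by rewrite scaler_eq0 subr_eq0 (negPf rab) => /eqP.
move=> a; rewrite inE => /orP[/eqP ->|]; last exact: hs.
have /eqP := h (fun=> 1) (fun=> ltr01).
rewrite big_cons big1_seq ?addr0; last by move=> i /= /hs ->; rewrite scaler0.
by rewrite scaler_eq0 (negPf (zpow_neq0 _ _)) => /eqP.
Qed.

Lemma termwiseE (k : nat) (phi : 'rV[C]_k.+2 -> X -> X) (c : terms k)
    (p : gfun k) (z : 'I_k.+2 -> R) :
  (forall a x y, phi a (x - y) = phi a x - phi a y) -> represents c p ->
  termwise phi p z = \sum_(a <- c.1) zpow z a *: phi a (c.2 a).
Proof.
move=> phiB cp; rewrite /termwise.
have phi0 a : phi a 0 = 0 by rewrite -[in LHS](subrr 0) phiB subrr.
have c0p : represents (terms_of p) p.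
  rewrite /terms_of; case: pselect => [h|[]]; last by exists c.
  exact: (projT2 (cid h)).
set c0 := terms_of p in c0p *.
pose U := (c0.1 `|` c.1)%fset.
pose eta (d : terms k) a := if a \in d.1 then d.2 a else 0.
have widen (d : terms k) (F : 'rV[C]_k.+2 -> X -> X) :
    (d.1 `<=` U)%fset -> (forall a, F a 0 = 0) ->
    \sum_(a <- d.1) F a (d.2 a) = \sum_(a <- U) F a (eta d a).
  move=> dU F0; transitivity (\sum_(a <- d.1) F a (eta d a)).
    by apply: eq_big_seq => a ad; rewrite /eta ad.
  by apply: big_fset_incl => // a _ /negPf ad; rewrite /eta ad.
have eta_eq (a : 'rV[C]_k.+2) : a \in U -> eta c0 a = eta c a.
  move=> aU; apply/eqP; rewrite -subr_eq0; apply/eqP.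
  apply: (zpow_free (s := U) (xi := fun a => eta c0 a - eta c a)
    (fset_uniq U)) => //.
  move=> z' z0; under eq_bigr do rewrite scalerBr.
  rewrite sumrB.
  rewrite -(widen c0 (fun a x => zpow z' a *: x)) ?fsubsetUl//; last first.
    by move=> ?; rewrite scaler0.
  rewrite -(widen c (fun a x => zpow z' a *: x)) ?fsubsetUr//; last first.
    by move=> ?; rewrite scaler0.
  by rewrite -c0p// -cp// subrr.
rewrite (widen c0 (fun a x => zpow z a *: phi a x)) ?fsubsetUl//; last first.
  by move=> ?; rewrite phi0 scaler0.
rewrite (widen c (fun a x => zpow z a *: phi a x)) ?fsubsetUr//; last first.
  by move=> ?; rewrite phi0 scaler0.
by apply: eq_big_seq => a /eta_eq ->.
Qed.

End Classes.

Definition opZ (R : realType) (n : nat) (A : 'M[R[i]]_n) (k : nat)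
    (p : gfun 'cV[R[i]]_n k) : gfun 'cV[R[i]]_n k :=
  termwise (fun a xi => invmx (A + (a 0 ord0)%:M) *m xi) p.

Section Expansion.
Variables (R : realType) (n : nat).
Local Notation C := R[i].
Local Notation X := 'cV[C]_n.

(* Sequences indexed by k = 1, 2, ... in the mathematics are indexed from 0
   here and below, so the N-th remainder uses the terms 0, ..., N. *)
Definition power_expansion (g : R -> X) (nk : nat -> nat) (gam : nat -> R)
    (g_ : nat -> R -> X) : Prop :=
  (forall k, scrF_m 0 (nk k) (- gam k) (g_ k)) /\
  forall N, exists mu : R, gam N < mu /\
    bigO_pinfty (fun t => g t - \sum_(k < N.+1) g_ k t) (fun t => t `^ (- mu)).

Variables (calG : forall m, {ffun 'I_m -> X} -> X)
  (mu : nat -> R) (nk : nat -> nat) (q : forall k, gfun X (nk k)).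

(* Both sums have finite support when mu is positive, increasing and
   divergent. *)
Definition Gterm (k : nat) : gfun X (nk k) := fun z =>
  \sum_(m \in [set m | (2 <= m)%N])
    \sum_(j \in [set j : {ffun 'I_m -> nat} | \sum_(l < m) mu (j l) = mu k])
      calG [ffun l => widen_gfun (@q (j l)) z].

Definition chi (k : nat) : gfun X (nk k) := fun z =>
  if [pick l : 'I_k | mu l + 1 == mu k] is Some l
  then widen_gfun (opR (@q l)) z else 0.

End Expansion.

Arguments Gterm {R n} calG mu {nk} q k z.
Arguments chi {R n} mu {nk} q k z.

(* Main.v *)
Require Import Defs.
From HB Require Import structures.
From mathcomp Require Import all_boot all_order all_algebra.
From mathcomp Require Import finmap.
From mathcomp Require Import all_classical all_reals all_analysis.
From mathcomp Require Import complex ring lra.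

Set Implicit Arguments.
Unset Strict Implicit.
Unset Printing Implicit Defensive.

Import Order.TTheory GRing.Theory Num.Theory.
Import numFieldNormedType.Exports.
Import Normc.

Local Open Scope classical_set_scope.
Local Open Scope complex_scope.
Local Open Scope ring_scope.

(** The formal series with coefficients [q k] solves the equation term by term:
along [Lhat] the derivative of [q k] is [opM ord0 (q k) + opR (q k)], [opZ]
inverts [A + opM ord0], and [opR (q l)] has the decay rate [mu l + 1], so it is
compensated by [chi].  With [s] the sum of the first [N + 1] terms, the
difference [w = y - s] therefore satisfies [w' = - A w + g], where [g] is the sum
of the difference of the nonlinear terms at [y] and [s], which is at most
[eps |w|] because both are small and the nonlinearity is at least quadratic, and
of an error that is [O(t^(-nu))] for every [nu < mu N.+1]; here the closure of
the range of [mu] under addition and successor is used.  A quadratic Lyapunov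
function for [A] then gives [w = O(t^(-nu))] directly, without induction on [N]
and without the variation of constants formula. *)

(** * Norms and coercivity *)

(** Two points shape the estimates. A term of decay rate [mu k] may carry powers of iterated
    logarithms, so it is only O(t^(-nu)) for each nu < [mu k]. The predicate [powO] records exactly
    this; sums and multilinear maps respect it, and the loss is repaid once, at the very end, in the
    gap between [mu N] and [mu N.+1]. Induction on N is avoidable because the constant eps of the
    decay lemma depends on A only, and because the difference of the nonlinear terms is measured by
    |w|, not by a power of t: for this part it is enough that y and s become small. A rate for y
    itself is needed only in the remainder of G at y. That rate, [mu 0], comes from the same decay
    lemma with s = 0, and the degree M at which G is truncated is then taken so large that M [mu 0]
    is at least 2 [mu N.+1]. A change of basis is needed in the Lyapunov function because a spectrum
    in the right half plane does not make Re (A x, x) positive for the given inner product. *)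

Section Norms.
Variable R : realType.
Local Notation C := R[i].

Lemma normcE2 (z : C) : normc z ^+ 2 = complex.Re z ^+ 2 + complex.Im z ^+ 2.
Proof. by case: z => a b /=; rewrite sqr_sqrtr// addr_ge0 ?sqr_ge0. Qed.

Lemma normc_ge0 (z : C) : 0 <= normc z.
Proof. by case: z => a b /=; exact: sqrtr_ge0. Qed.

Lemma normc_real (r : R) : normc r%:C = `|r|.
Proof. by rewrite /= expr0n addr0 sqrtr_sqr. Qed.

Lemma normc_sum (I : Type) (r : seq I) (P : pred I) (F : I -> C) :
  normc (\sum_(i <- r | P i) F i) <= \sum_(i <- r | P i) normc (F i).
Proof.
elim/big_rec2: _ => [|i x y _ h]; first by rewrite normc0.
by rewrite (le_trans (le_normcD _ _))// lerD2l.
Qed.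

Lemma normc_Re (z : C) : `|complex.Re z| <= normc z.
Proof.
by rewrite -ler_sqr ?nnegrE ?normc_ge0// normcE2 real_normK ?num_real// lerDl sqr_ge0.
Qed.

Lemma normc_Im (z : C) : `|complex.Im z| <= normc z.
Proof.
by rewrite -ler_sqr ?nnegrE ?normc_ge0// normcE2 real_normK ?num_real// lerDr sqr_ge0.
Qed.

Lemma normc_cexp (z : C) : normc (cexp z) = expR (complex.Re z).
Proof.
rewrite /cexp normcM normc_real ger0_norm ?expR_ge0//=.
by rewrite cos2Dsin2 sqrtr1 mulr1.
Qed.

(** This is Re (conj(a) b), the inner product of C seen as the real plane; twice it is the
    derivative of |a|^2 in the direction b. *)
Definition rdot (a b : C) : R :=
  complex.Re a * complex.Re b + complex.Im a * complex.Im b.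

Lemma rdotD a b c : rdot a (b + c) = rdot a b + rdot a c.
Proof. by case: a b c => [? ?] [? ?] [? ?]; rewrite /rdot /=; ring. Qed.

Lemma rdotN a b : rdot a (- b) = - rdot a b.
Proof. by case: a b => [? ?] [? ?]; rewrite /rdot /=; ring. Qed.

Lemma rdot0 a : rdot a 0 = 0.
Proof. by case: a => [? ?]; rewrite /rdot /=; ring. Qed.

Lemma rdot_sum a (I : Type) (r : seq I) (P : pred I) (F : I -> C) :
  rdot a (\sum_(i <- r | P i) F i) = \sum_(i <- r | P i) rdot a (F i).
Proof. exact: (big_morph _ (rdotD a) (rdot0 a)). Qed.

Lemma rdotMl (a l : C) : rdot a (l * a) = complex.Re l * normc a ^+ 2.
Proof. by rewrite normcE2; case: a l => [? ?] [? ?]; rewrite /rdot /=; ring. Qed.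

Lemma rdot_le (a b : C) : `|rdot a b| <= normc a * normc b.
Proof.
rewrite -ler_sqr ?nnegrE ?mulr_ge0 ?normc_ge0// real_normK ?num_real//.
rewrite exprMn !normcE2 -subr_ge0; case: a b => [a b] [c d]; rewrite /rdot /=.
rewrite (_ : _ - _ = (a * d - b * c) ^+ 2); last by ring.
exact: sqr_ge0.
Qed.

Section Nrm1.
Variable n : nat.
Local Notation X := 'cV[C]_n.

(** Triangle inequality and matrix bounds are immediate coordinatewise for this norm; passing to
    [enorm] and back costs only a factor n. *)
Definition nrm1 (x : X) : R := \sum_i normc (x i 0).

Lemma nrm1_ge0 x : 0 <= nrm1 x.
Proof. by apply: sumr_ge0 => i _; exact: normc_ge0. Qed.

Lemma nrm1_0 : nrm1 0 = 0.
Proof. by rewrite /nrm1 big1// => i _; rewrite mxE normc0. Qed.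

Lemma nrm1D x y : nrm1 (x + y) <= nrm1 x + nrm1 y.
Proof.
by rewrite /nrm1 -big_split; apply: ler_sum => i _; rewrite mxE; exact: le_normcD.
Qed.

Lemma nrm1N x : nrm1 (- x) = nrm1 x.
Proof. by apply: eq_bigr => i _; rewrite mxE normcN. Qed.

Lemma nrm1_sum (I : Type) (r : seq I) (P : pred I) (F : I -> X) :
  nrm1 (\sum_(i <- r | P i) F i) <= \sum_(i <- r | P i) nrm1 (F i).
Proof.
elim/big_rec2: _ => [|i x y _ h]; first by rewrite nrm1_0.
by rewrite (le_trans (nrm1D _ _))// lerD2l.
Qed.

Lemma nrm1Z (a : C) x : nrm1 (a *: x) = normc a * nrm1 x.
Proof. by rewrite /nrm1 mulr_sumr; apply: eq_bigr => i _; rewrite mxE normcM. Qed.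

Lemma normc_le_nrm1 (x : X) i : normc (x i 0) <= nrm1 x.
Proof. by rewrite /nrm1 (bigD1 i)//= lerDl sumr_ge0// => j _; exact: normc_ge0. Qed.

Lemma nrm1_mulmx (M : 'M[C]_n) : exists K, 0 < K /\
  forall x, nrm1 (M *m x) <= K * nrm1 x.
Proof.
exists (1 + \sum_i \sum_j normc (M i j)); split.
  rewrite (lt_le_trans ltr01)// lerDl.
  by apply: sumr_ge0 => i _; apply: sumr_ge0 => j _; exact: normc_ge0.
move=> x; rewrite mulrDl mul1r ler_wpDl ?nrm1_ge0// mulr_suml.
apply: ler_sum => i _; rewrite mxE (le_trans (normc_sum _ _ _))// mulr_suml.
apply: ler_sum => j _; rewrite normcM ler_wpM2l ?normc_ge0//.
exact: normc_le_nrm1.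
Qed.

Lemma enorm_sq (x : X) : enorm x ^+ 2 = \sum_i normc (x i 0) ^+ 2.
Proof.
rewrite /enorm sqr_sqrtr; last first.
  by apply: sumr_ge0 => i _; rewrite addr_ge0 ?sqr_ge0.
by apply: eq_bigr => i _; rewrite normcE2.
Qed.

Lemma enorm_ge0 (x : X) : 0 <= enorm x.
Proof. exact: sqrtr_ge0. Qed.

Lemma normc_le_enorm (x : X) i : normc (x i 0) <= enorm x.
Proof.
rewrite -ler_sqr ?nnegrE ?normc_ge0 ?enorm_ge0// enorm_sq (bigD1 i)//= lerDl.
by apply: sumr_ge0 => j _; exact: sqr_ge0.
Qed.

Lemma nrm1_le_enorm (x : X) : nrm1 x <= n%:R * enorm x.
Proof.
rewrite (le_trans (ler_sum _ (fun i _ => normc_le_enorm x i)))//.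
by rewrite sumr_const card_ord mulr_natl.
Qed.

Lemma enorm_le_nrm1 (x : X) : enorm x <= nrm1 x.
Proof.
rewrite -ler_sqr ?nnegrE ?nrm1_ge0 ?enorm_ge0// enorm_sq.
rewrite [leRHS]expr2 {2}/nrm1 mulr_sumr; apply: ler_sum => i _.
by rewrite expr2 ler_wpM2r ?normc_ge0// normc_le_nrm1.
Qed.

End Nrm1.

(** The inverse of 1 plus the sum of all inverses works, even for an empty index type, where a
    minimum would not exist. *)
Lemma positive_lower_bound (I : finType) (u : I -> R) :
  (forall i, 0 < u i) -> exists c, 0 < c /\ forall i, c <= u i.
Proof.
move=> u0; have s0 : 0 <= \sum_i (u i)^-1.
  by apply: sumr_ge0 => i _; rewrite invr_ge0 ltW.
have s1 : 0 < 1 + \sum_i (u i)^-1 by rewrite ltr_pwDl.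
exists (1 + \sum_i (u i)^-1)^-1; rewrite invr_gt0; split=> // i.
rewrite -[u i]invrK lef_pV2 ?posrE ?invr_gt0// (bigD1 i)//= addrCA lerDl.
by rewrite addr_ge0// sumr_ge0// => j _; rewrite invr_ge0 ltW.
Qed.

(* Schur triangularisation followed by conjugation with diag(1, d, d^2, ...)
   makes the off-diagonal entries as small as we like. *)
Lemma coercive_form n (A : 'M[C]_n) : (0 < n)%N ->
  (forall a : C, eigenvalue A a -> 0 < complex.Re a) ->
  exists (S S' B : 'M[C]_n) (c : R),
    [/\ S' *m S = 1%:M, S *m A = B *m S, 0 < c &
      forall x : 'cV[C]_n, c * (\sum_i normc (x i 0) ^+ 2) <=
        \sum_i rdot (x i 0) ((B *m x) i 0)].
Proof.
move=> n0 specA; have [P Pu] := Schur A n0.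
have Punit := unitarymx_unit Pu; move=> Ptrig.
pose T := P *m A *m invmx P.
have {Ptrig} Ttrig : is_trig_mx T by move: Ptrig; rewrite /= -[T]conjumx.
have TP : T *m P = P *m A by rewrite /T mulmxKV.
have Tpos i : 0 < complex.Re (T i i).
  apply: specA; rewrite eigenvalue_root_char.
  (* Similar matrices share their characteristic polynomial, and that of the triangular T vanishes
     at each diagonal entry. *)
  have -> : char_poly A = char_poly T.
    rewrite /char_poly.
    have -> : char_poly_mx T =
        map_mx polyC P *m char_poly_mx A *m map_mx polyC (invmx P).
      rewrite /char_poly_mx mulmxBr mulmxBl -!map_mxM -/T; congr (_ - _).
      by rewrite scalar_mxC -mulmxA -map_mxM mulmxV// map_mx1 mulmx1.
    rewrite !det_mulmx mulrAC -det_mulmx -map_mxM mulmxV// map_mx1 det1.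
    by rewrite mul1r.
  rewrite char_poly_trig// (bigD1 i)//= rootM root_XsubC eqxx//.
have [c0 [c00 c0T]] := positive_lower_bound Tpos.
pose M := 1 + \sum_i \sum_j normc (T i j).
have M1 : 1 <= M.
  rewrite lerDl.
  by apply: sumr_ge0 => i _; apply: sumr_ge0 => j _; exact: normc_ge0.
have MT i j : normc (T i j) <= M.
  rewrite /M (bigD1 i)//= (bigD1 j)//= addrCA -addrA lerDl !addr_ge0//.
    by apply: sumr_ge0 => ? _; exact: normc_ge0.
  by apply: sumr_ge0 => ? _; apply: sumr_ge0 => ? _; exact: normc_ge0.
have M0 : 0 < M by rewrite (lt_le_trans ltr01).
have nR0 : 0 < n%:R :> R by rewrite ltr0n.
(* The off-diagonal entries will cost at most 2 n M d times the sum of squares, which is to use up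
   no more than half of the diagonal bound c0; d <= 1 gives d^(i-j) <= d for j < i. *)
have [d [d0 d1 dM]] : exists d : R, [/\ 0 < d, d <= 1 & n%:R * M * d *+ 2 <= c0 / 2].
  exists (Num.min 1 (c0 / (4 * (n%:R * M)))); split.
  - by rewrite lt_min ltr01 divr_gt0// !mulr_gt0.
  - by rewrite ge_min lexx.
  - have : Num.min 1 (c0 / (4 * (n%:R * M))) <= c0 / (4 * (n%:R * M)).
      by rewrite ge_min lexx orbT.
    rewrite ler_pdivlMr ?mulr_gt0//; lra.
have dn0 : d != 0 by rewrite gt_eqF.
pose dC : C := d%:C.
have dC0 : dC != 0 by rewrite /dC fmorph_eq0.
(* S is diag(d^i) P and S' its inverse, so B = S A S' has the entries T i j d^(i-j). As T is lower
   triangular, each nonzero off-diagonal entry has at least one factor d. *)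
pose S := \matrix_(i, j) (dC ^+ i * P i j).
pose S' := \matrix_(i, j) (invmx P i j * dC ^- j).
pose B := \matrix_(i, j) (T i j * (dC ^+ i * dC ^- j)).
exists S, S', B, (c0 / 2); split.
- rewrite -(mulVmx Punit); apply/matrixP => i k; rewrite !mxE.
  apply: eq_bigr => j _; rewrite !mxE mulrA -(mulrA (invmx P i j)).
  by rewrite mulVf ?expf_neq0// mulr1.
- apply/matrixP => i k; rewrite !mxE.
  transitivity (dC ^+ i * (P *m A) i k).
    by rewrite mxE mulr_sumr; apply: eq_bigr => j _; rewrite mxE mulrA.
  rewrite -TP mxE mulr_sumr; apply: eq_bigr => j _; rewrite !mxE.
  rewrite [RHS]mulrA -[_ * dC ^+ j]mulrA -[_ * dC ^+ j]mulrA.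
  by rewrite mulVf ?expf_neq0// mulr1 [in RHS]mulrAC mulrA [dC ^+ i * _]mulrC mulrAC.
- by rewrite divr_gt0.
move=> x.
(* The error term is charged to diagonal pairs as well, although they do not need it, so that the
   double sum of the lower bounds has a closed form. *)
have key i j : (i == j)%:R * (c0 * normc (x i 0) ^+ 2)
    - M * d * (normc (x i 0) ^+ 2 + normc (x j 0) ^+ 2)
    <= rdot (x i 0) (B i j * x j 0).
  have r0 : 0 <= M * d * (normc (x i 0) ^+ 2 + normc (x j 0) ^+ 2).
    by rewrite mulr_ge0 ?addr_ge0 ?sqr_ge0// mulr_ge0// ltW.
  have [ij|ij] := eqVneq i j.
    rewrite -ij mul1r lerBlDr ler_wpDr//; first by rewrite -ij in r0.
    rewrite rdotMl mxE mulfV ?expf_neq0// mulr1.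
    by rewrite ler_wpM2r ?sqr_ge0.
  rewrite mul0r add0r lerNl -rdotN (le_trans (ler_norm _))//.
  rewrite (le_trans (rdot_le _ _))// normcN normcM.
  have Bij : normc (B i j) <= M * d.
    rewrite mxE; have [ltij|] := ltnP i j.
      by rewrite (is_trig_mxP Ttrig)// mul0r normc0 mulr_ge0// ltW.
    rewrite leq_eqVlt eq_sym val_eqE (negPf ij)/= => ltji.
    rewrite normcM ler_pM ?normc_ge0//.
    rewrite -exprB ?(ltnW ltji) ?unitfE// /dC -rmorphXn normc_real.
    rewrite ger0_norm; last by rewrite exprn_ge0// ltW.
    by rewrite -[leRHS]expr1; apply: ler_wiXn2l; rewrite ?subn_gt0// ltW.
  set a := normc (x i 0); set b := normc (x j 0).
  have a0 : 0 <= a by exact: normc_ge0.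
  have b0 : 0 <= b by exact: normc_ge0.
  rewrite mulrCA; apply: ler_pM => //; rewrite ?normc_ge0 ?mulr_ge0//.
  have : 0 <= (a - b) ^+ 2 by exact: sqr_ge0.
  have := sqr_ge0 a; have := sqr_ge0 b; rewrite -[a ^+ 2]/(a * a) -[b ^+ 2]/(b * b).
  by rewrite -[(a - b) ^+ 2]/((a - b) * (a - b)); lra.
have -> : \sum_i rdot (x i 0) ((B *m x) i 0) =
    \sum_i \sum_j rdot (x i 0) (B i j * x j 0).
  by apply: eq_bigr => i _; rewrite mxE rdot_sum.
apply: (@le_trans _ _ (\sum_i \sum_j ((i == j)%:R * (c0 * normc (x i 0) ^+ 2)
    - M * d * (normc (x i 0) ^+ 2 + normc (x j 0) ^+ 2)))); last first.
  by apply: ler_sum => i _; apply: ler_sum => j _; exact: key.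
set Q := \sum_i normc (x i 0) ^+ 2.
have Q0 : 0 <= Q by apply: sumr_ge0 => i _; exact: sqr_ge0.
have -> : \sum_i \sum_j ((i == j)%:R * (c0 * normc (x i 0) ^+ 2)
    - M * d * (normc (x i 0) ^+ 2 + normc (x j 0) ^+ 2)) =
  c0 * Q - M * d * (n%:R * Q *+ 2).
  under eq_bigr do rewrite sumrB -mulr_suml -mulr_sumr big_split/= sumr_const card_ord.
  rewrite sumrB; congr (_ - _).
    rewrite /Q mulr_sumr; apply: eq_bigr => i _.
    rewrite (bigD1 i)//= eqxx big1 ?addr0 ?mul1r// => j ji.
    by rewrite eq_sym (negPf ji).
  rewrite -mulr_sumr big_split/= sumr_const card_ord sumrMnl.
  by rewrite -/Q mulr2n mulr_natl.
have : n%:R * M * d *+ 2 * Q <= c0 / 2 * Q by rewrite ler_wpM2r.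
lra.
Qed.

End Norms.

(** * Differentiation and decay of perturbed linear systems *)

Section Derivatives.
Variable R : realType.
Local Notation C := R[i].

Lemma ReM (x y : C) : complex.Re (x * y) =
  complex.Re x * complex.Re y - complex.Im x * complex.Im y.
Proof. by case: x y => [? ?] []. Qed.

Lemma ImM (x y : C) : complex.Im (x * y) =
  complex.Re x * complex.Im y + complex.Im x * complex.Re y.
Proof. by case: x y => [? ?] []. Qed.

(** Splitting into real and imaginary parts reduces all differentiation to the rules for real
    functions of a real variable. *)
Definition cderive (g : R -> C) (t : R) (d : C) : Prop :=
  is_derive t (1 : R) (fun s => complex.Re (g s)) (complex.Re d) /\
  is_derive t (1 : R) (fun s => complex.Im (g s)) (complex.Im d).

Lemma cderive_cst (c : C) t : cderive (fun=> c) t 0.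
Proof. by split; exact: is_derive_cst. Qed.

Lemma cderiveD f g t df dg : cderive f t df -> cderive g t dg ->
  cderive (fun s => f s + g s) t (df + dg).
Proof.
move=> [f1 f2] [g1 g2]; split; rewrite raddfD /=.
  by rewrite (_ : (fun s => _) = (fun s => complex.Re (f s)) +
    (fun s => complex.Re (g s))); [exact: is_deriveD|apply/funext => s; rewrite raddfD].
by rewrite (_ : (fun s => _) = (fun s => complex.Im (f s)) +
    (fun s => complex.Im (g s))); [exact: is_deriveD|apply/funext => s; rewrite raddfD].
Qed.

Lemma cderiveZ (c : C) f t df : cderive f t df ->
  cderive (fun s => c * f s) t (c * df).
Proof.
case: c df => [a b] [u v] [f1 f2]; split => /=.
  rewrite (_ : (fun s => _) = a \*: (fun s => complex.Re (f s)) -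
    b \*: (fun s => complex.Im (f s))); first exact: is_deriveB.
  by apply/funext => s; rewrite ReM.
rewrite (_ : (fun s => _) = a \*: (fun s => complex.Im (f s)) +
    b \*: (fun s => complex.Re (f s))); first exact: is_deriveD.
by apply/funext => s; rewrite ImM.
Qed.

Lemma cderive_sum (I : Type) (r : seq I) (P : pred I) (f : I -> R -> C) t df :
  (forall i, P i -> cderive (f i) t (df i)) ->
  cderive (fun s => \sum_(i <- r | P i) f i s) t (\sum_(i <- r | P i) df i).
Proof.
move=> h; elim: r => [|i r IH].
  rewrite big_nil (_ : (fun s => _) = fun=> 0); first exact: cderive_cst.
  by apply/funext => s; rewrite big_nil.
rewrite big_cons; case: ifPn => Pi; last first.
  rewrite (_ : (fun s => _) = fun s => \sum_(i <- r | P i) f i s)//.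
  by apply/funext => s; rewrite big_cons (negPf Pi).
rewrite (_ : (fun s => _) = fun s => f i s + \sum_(i <- r | P i) f i s).
  by apply: cderiveD => //; exact: h.
by apply/funext => s; rewrite big_cons Pi.
Qed.

Lemma cderive_real (g : R -> R) t d : is_derive t (1 : R) g d ->
  cderive (fun s => (g s)%:C) t d%:C.
Proof. by move=> h; split => //=; exact: is_derive_cst. Qed.

Lemma cderive_cexp f t df : cderive f t df ->
  cderive (fun s => cexp (f s)) t (cexp (f t) * df).
Proof.
move=> [f1 f2].
have e1 : is_derive t (1 : R) (expR \o (fun s => complex.Re (f s)))
  (expR (complex.Re (f t)) * complex.Re df) by exact: is_derive1_comp.
have c1 : is_derive t (1 : R) (cos \o (fun s => complex.Im (f s)))
  (- sin (complex.Im (f t)) * complex.Im df) by exact: is_derive1_comp.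
have s1 : is_derive t (1 : R) (sin \o (fun s => complex.Im (f s)))
  (cos (complex.Im (f t)) * complex.Im df) by exact: is_derive1_comp.
split.
  rewrite (_ : (fun s => _) = (expR \o (fun s => complex.Re (f s))) *
    (cos \o (fun s => complex.Im (f s)))); last first.
    by apply/funext => s; rewrite /cexp /= mul0r subr0.
  apply: (is_derive_eq (is_deriveM e1 c1)).
  by rewrite /cexp; case: df {f1 f2 e1 c1 s1} => a b /=; rewrite /GRing.scale/=; ring.
rewrite (_ : (fun s => _) = (expR \o (fun s => complex.Re (f s))) *
    (sin \o (fun s => complex.Im (f s)))); last first.
  by apply/funext => s; rewrite /cexp /= mul0r addr0.
apply: (is_derive_eq (is_deriveM e1 s1)).
by rewrite /cexp; case: df {f1 f2 e1 c1 s1} => a b /=; rewrite /GRing.scale/=; ring.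
Qed.

Lemma is_derive_bigsum (I : Type) (r : seq I) (f : I -> R -> R) t df :
  (forall i, is_derive t (1 : R) (f i) (df i)) ->
  is_derive t (1 : R) (fun s => \sum_(i <- r) f i s) (\sum_(i <- r) df i).
Proof.
move=> h; have := @cderive_sum I r predT (fun i s => (f i s)%:C) t
  (fun i => (df i)%:C) (fun i _ => cderive_real (h i)).
case; rewrite -rmorph_sum/= => + _.
by under eq_fun do rewrite -rmorph_sum/=.
Qed.

Lemma is_derive_normc2 f t df : cderive f t df ->
  is_derive t (1 : R) (fun s => normc (f s) ^+ 2) (2 * rdot (f t) df).
Proof.
move=> [f1 f2]; under eq_fun do rewrite normcE2.
apply: (is_derive_eq (is_deriveD (is_deriveM f1 f1) (is_deriveM f2 f2))).
by rewrite /rdot /GRing.scale/=; ring.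
Qed.

Section Vector.
Variable n : nat.
Local Notation X := 'cV[C]_n.

Definition vderive (w : R -> X) (t : R) (d : X) : Prop :=
  forall i, cderive (fun s => w s i 0) t (d i 0).

Lemma vderiveD w v t dw dv : vderive w t dw -> vderive v t dv ->
  vderive (fun s => w s + v s) t (dw + dv).
Proof.
move=> h k i; rewrite mxE (_ : (fun s => _) = fun s => w s i 0 + v s i 0).
  exact: cderiveD.
by apply/funext => s; rewrite mxE.
Qed.

Lemma vderiveN w t dw : vderive w t dw -> vderive (fun s => - w s) t (- dw).
Proof.
move=> h i; rewrite mxE -mulN1r (_ : (fun s => _) = fun s => -1 * w s i 0).
  exact: cderiveZ.
by apply/funext => s; rewrite mxE mulN1r.
Qed.

Lemma vderive_sum (I : Type) (r : seq I) (P : pred I) (f : I -> R -> X) t df :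
  (forall i, P i -> vderive (f i) t (df i)) ->
  vderive (fun s => \sum_(i <- r | P i) f i s) t (\sum_(i <- r | P i) df i).
Proof.
move=> h k; rewrite summxE (_ : (fun s => _) =
    fun s => \sum_(i <- r | P i) f i s k 0).
  by apply: cderive_sum => i Pi; exact: h.
by apply/funext => s; rewrite summxE.
Qed.

Lemma vderiveZr (g : R -> C) t d (x : X) : cderive g t d ->
  vderive (fun s => g s *: x) t (d *: x).
Proof.
move=> h i; rewrite mxE mulrC (_ : (fun s => _) = fun s => x i 0 * g s).
  exact: cderiveZ.
by apply/funext => s; rewrite mxE mulrC.
Qed.

Lemma vderive_mulmx (M : 'M[C]_n) w t d : vderive w t d ->
  vderive (fun s => M *m w s) t (M *m d).
Proof.
move=> h i; rewrite mxE (_ : (fun s => _) = fun s => \sum_j M i j * w s j 0).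
  by apply: cderive_sum => j _; exact: cderiveZ.
by apply/funext => s; rewrite mxE.
Qed.

Lemma ederive_vderive w t d : is_ederive w t d -> vderive w t d.
Proof.
rewrite /is_ederive /ecvg => h i.
(* Re and Im are handled together: a real-linear functional bounded by the modulus carries the
   convergence of the difference quotients over to a coordinate. *)
suff key (pr : C -> R) : {morph pr : x y / x - y} ->
    (forall r x, pr (r%:C * x) = r * pr x) -> (forall x, `|pr x| <= normc x) ->
    is_derive t (1 : R) (fun s => pr (w s i 0)) (pr (d i 0)).
  split; apply: key.
  - by move=> x y; rewrite raddfB.
  - by move=> r [a b] /=; rewrite mul0r subr0.
  - exact: normc_Re.
  - by move=> x y; rewrite raddfB.
  - by move=> r [a b] /=; rewrite mul0r addr0.
  - exact: normc_Im.
move=> prB prZ prn.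
have cv : (fun s => s^-1 *: (((fun s => pr (w s i 0)) \o shift t) (s *: (1 : R))
    - pr (w t i 0))) s @[s --> 0^'] --> pr (d i 0).
  apply/subr_cvg0; apply/norm_cvg0P.
  apply: (squeeze_cvgr _ (cvg_cst 0) h).
  apply: nearW => s; rewrite normr_ge0/=.
  apply: le_trans (normc_le_enorm _ i); rewrite !mxE.
  apply: le_trans (prn _); rewrite prB prZ prB /GRing.scale/= mulr1 [t + s]addrC.
  by [].
by split; [apply/cvg_ex; exists (pr (d i 0))|exact: cvg_lim cv].
Qed.

(* e^(ct) (V - M t^(-g)) is nonincreasing once M and t are large. *)
Lemma power_comparison (V dV : R -> R) (c K g T : R) : 0 < c ->
  (forall t, T <= t -> is_derive t (1 : R) V (dV t)) ->
  (forall t, T <= t -> dV t <= - c * V t + K * t `^ (- g)) ->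
  exists M, \forall t \near +oo, V t <= M * t `^ (- g).
Proof.
move=> c0 dVt dVle.
(* Beyond T1 one has |g| / t <= c / 2, so differentiating t^(-g) spends at most half of the rate
   c. *)
pose T1 := Num.max T (Num.max 1 (2 * `|g| / c)).
have TT1 : T <= T1 by rewrite le_max lexx.
have T11 : 1 <= T1 by rewrite !le_max lexx orbT.
have gT1 : 2 * `|g| / c <= T1 by rewrite !le_max lexx !orbT.
(* The first entry lets the remaining half of c absorb the forcing K t^(-g); the second makes u
   nonpositive at T1. *)
pose M := Num.max (2 * `|K| / c) (V T1 / T1 `^ (- g)).
have MK : 2 * `|K| / c <= M by rewrite le_max lexx.
have MV : V T1 / T1 `^ (- g) <= M by rewrite le_max lexx orbT.
have M0 : 0 <= M by rewrite (le_trans _ MK)// divr_ge0 ?mulr_ge0// ltW.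
exists M.
pose u t := expR (c * t) * (V t - M * t `^ (- g)).
pose du t := expR (c * t) * (c * (V t - M * t `^ (- g)) +
  (dV t - M * (- g * t `^ (- g - 1)))).
have udu t : T1 <= t -> is_derive t (1 : R) u (du t).
  move=> T1t; have t0 : 0 < t by rewrite (lt_le_trans ltr01)// (le_trans T11).
  have i1 : is_derive t (1 : R) (expR \o (fun s => c *: s)) (expR (c * t) * (c *: 1)).
    by apply: is_derive1_comp; exact: is_deriveZ.
  have i2 : is_derive t (1 : R) (M \*: (fun s => s `^ (- g)))
      (M *: (- g * t `^ (- g - 1))).
    by apply: is_deriveZ; exact: is_derive1_powR.
  have i3 := dVt _ (le_trans TT1 T1t).
  have -> : u = (expR \o (fun s => c *: s)) * (V - (M \*: (fun s => s `^ (- g)))).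
    by apply/funext.
  apply: (is_derive_eq (is_deriveM i1 (is_deriveB i3 i2))).
  rewrite -[LHS]/(expR (c * t) * (dV t - M * (- g * t `^ (- g - 1))) +
    (V t - M * t `^ (- g)) * (expR (c * t) * (c * 1))) /du; ring.
have du0 t : T1 <= t -> du t <= 0.
  move=> T1t; have t0 : 0 < t by rewrite (lt_le_trans ltr01)// (le_trans T11).
  rewrite /du pmulr_rle0 ?expR_gt0//.
  have := dVle _ (le_trans TT1 T1t).
  have p0 : 0 < t `^ (- g) by exact: powR_gt0.
  have -> : t `^ (- g - 1) = t `^ (- g) / t.
    by rewrite powRD ?(gt_eqF t0) ?implybT// powR_inv1// ltW.
  set p := t `^ (- g) in p0 *.
  have gt2 : `|g| / t <= c / 2.
    rewrite ler_pdivrMr//.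
    have := le_trans gT1 T1t; rewrite ler_pdivrMr//; lra.
  have : M * (g * (p / t)) <= M * (c / 2 * p).
    rewrite ler_wpM2l// mulrCA mulrC ler_wpM2r ?(ltW p0)//.
    by rewrite (le_trans _ gt2)// ler_wpM2r ?invr_ge0 ?(ltW t0)// ler_norm.
  have : K * p <= M * c / 2 * p.
    rewrite ler_wpM2r ?(ltW p0)// (le_trans (ler_norm K))//.
    by move: MK; rewrite ler_pdivrMr//; lra.
  lra.
near=> t.
have T1t : T1 <= t by near: t; apply: nbhs_pinfty_ge; exact: num_real.
have : u t <= u T1.
  apply: (@ler0_derive1_nincry _ u T1) => //.
  - move=> x; rewrite in_itv/= andbT => /ltW /udu; by case.
  - move=> x; rewrite in_itv/= andbT => /ltW T1x.
    by rewrite derive1E; have [_ ->] := udu _ T1x; exact: du0.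
  - apply: derivable_within_continuous => x; rewrite in_itv/= andbT => T1x.
    by case: (udu _ T1x).
have T10 : 0 < T1 by rewrite (lt_le_trans ltr01).
have uT1 : u T1 <= 0.
  rewrite /u pmulr_rle0 ?expR_gt0// subr_le0 -ler_pdivrMr//.
  exact: powR_gt0.
move=> ut; have := le_trans ut uT1.
by rewrite /u pmulr_rle0 ?expR_gt0// subr_le0.
Unshelve. all: by end_near. Qed.

(* The square of the Euclidean norm of S w, with S making A coercive, is a
   Lyapunov function. *)
Lemma perturbed_linear_decay (A : 'M[C]_n) : (0 < n)%N ->
  (forall a : C, eigenvalue A a -> 0 < complex.Re a) ->
  exists eps : R, 0 < eps /\
    forall (w g : R -> X) (gam K : R),
    (\forall t \near +oo, vderive w t (- (A *m w t) + g t)) ->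
    (\forall t \near +oo, nrm1 (g t) <= eps * nrm1 (w t) + K * t `^ (- gam)) ->
    exists M, \forall t \near +oo, nrm1 (w t) <= M * t `^ (- gam).
Proof.
move=> n0 specA.
have [S [S' [B [c [S'S SA c0 Bc]]]]] := coercive_form n0 specA.
have [a [a0 aS]] := nrm1_mulmx S.
have [b [b0 bS]] := nrm1_mulmx S'.
have [nn [nnE nR]] : exists nn : R, nn = n%:R ^+ 2 /\ 0 < nn.
  by exists (n%:R ^+ 2); rewrite exprn_gt0// ltr0n.
have e0 : 0 < c / (4 * (a * b * nn)) by rewrite divr_gt0// !mulr_gt0.
(* The factors a, b and n^2 are the costs of S, of S' and of comparing the squares of the two norms;
   with this eps the term eps |w| takes at most a quarter of the coercivity c. *)
exists (c / (4 * (a * b * nn))); split => // w g gam K dw gK.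
set eps := c / _ in e0 gK.
pose x t := S *m w t.
pose V t := \sum_i normc (x t i 0) ^+ 2.
pose dx t := - (B *m x t) + S *m g t.
pose dV t := 2 * \sum_i rdot (x t i 0) (dx t i 0).
have [T [T0 dwT gT]] : exists T, [/\ 0 < T, forall t, T <= t ->
    vderive w t (- (A *m w t) + g t) & forall t, T <= t ->
    nrm1 (g t) <= eps * nrm1 (w t) + K * t `^ (- gam)].
  have [M1 [_ h1]] := dw; have [M2 [_ h2]] := gK.
  exists (Num.max 1 (Num.max (M1 + 1) (M2 + 1))); split.
  - by rewrite lt_max ltr01.
  - move=> t; rewrite !ge_max => /and3P[_ h _]; apply: h1.
    by rewrite (lt_le_trans _ h)// ltrDl.
  - move=> t; rewrite !ge_max => /and3P[_ _ h]; apply: h2.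
    by rewrite (lt_le_trans _ h)// ltrDl.
have dxT t : T <= t -> vderive x t (dx t).
  move=> /dwT /(vderive_mulmx S); rewrite mulmxDr mulmxN mulmxA SA -mulmxA.
  exact.
have VdV t : T <= t -> is_derive t (1 : R) V (dV t).
  move=> /dxT h.
  rewrite /dV mulr_sumr; apply: is_derive_bigsum => i.
  exact: is_derive_normc2 (h i).
have wx t : nrm1 (w t) <= b * nrm1 (x t).
  by rewrite -[w t]mul1mx -S'S -mulmxA.
have V1 t : nrm1 (x t) ^+ 2 <= nn * V t.
  rewrite /V -enorm_sq nnE -exprMn ler_sqr ?nnegrE ?mulr_ge0 ?nrm1_ge0 ?enorm_ge0//.
  exact: nrm1_le_enorm.
pose K2 := (2 * a * K) ^+ 2 * nn / c.
(* V is quadratic in w, so the rate doubles here and is halved again by the final square root. *)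
have dVle t : T <= t -> dV t <= - (c / 2) * V t + K2 * t `^ (- (gam *+ 2)).
  move=> Tt; have t0 : 0 < t by rewrite (lt_le_trans T0).
  have p2 : t `^ (- (gam *+ 2)) = t `^ (- gam) ^+ 2.
    by rewrite -mulNrn -mulr_natr powRrM powR_mulrn// powR_ge0.
  rewrite p2; set p := t `^ (- gam).
  have p0 : 0 <= p by exact: powR_ge0.
  set N := nrm1 (x t).
  have N0 : 0 <= N by exact: nrm1_ge0.
  have V0 : 0 <= V t by apply: sumr_ge0 => i _; exact: sqr_ge0.
  have step1 : \sum_i rdot (x t i 0) (dx t i 0) <= - c * V t + N * nrm1 (S *m g t).
    have -> : \sum_i rdot (x t i 0) (dx t i 0) =
        - (\sum_i rdot (x t i 0) ((B *m x t) i 0)) +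
        \sum_i rdot (x t i 0) ((S *m g t) i 0).
      rewrite -sumrN -big_split; apply: eq_bigr => i _.
      by rewrite [dx t i 0]mxE rdotD [(- (B *m x t)) i 0]mxE rdotN.
    rewrite lerD//; first by rewrite mulNr lerN2 Bc.
    rewrite /N /nrm1 mulr_suml; apply: ler_sum => i _.
    rewrite (le_trans (ler_norm _))// (le_trans (rdot_le _ _))//.
    rewrite ler_wpM2l ?normc_ge0//; exact: normc_le_nrm1.
  have step2 : nrm1 (S *m g t) <= a * (eps * (b * N) + K * p).
    rewrite (le_trans (aS _))// ler_wpM2l ?(ltW a0)// (le_trans (gT _ Tt))//.
    by rewrite lerD2r ler_wpM2l ?(ltW e0)//.
  have step3 : N * nrm1 (S *m g t) <= N * (a * (eps * (b * N) + K * p)).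
    by rewrite ler_wpM2l.
  have step4 : a * b * eps * N ^+ 2 <= c / 4 * V t.
    have := V1 t; rewrite -/N => h.
    apply: (@le_trans _ _ (a * b * eps * (nn * V t))).
      by rewrite ler_wpM2l// (ltW (mulr_gt0 (mulr_gt0 a0 b0) e0)).
    rewrite /eps le_eqVlt; apply/orP; left; apply/eqP; field.
    by rewrite !gt_eqF//.
  (* Young's inequality, obtained by expanding the completed square in [h3]; it separates the
     forcing from V. *)
  have step5 : 2 * (a * K * p) * N <= c / 2 * V t + K2 * p ^+ 2.
    have h : N ^+ 2 / nn <= V t by rewrite ler_pdivrMr// mulrC V1.
    have h2 : c / 2 * (N ^+ 2 / nn) <= c / 2 * V t.
      by rewrite ler_wpM2l// ltW// divr_gt0.
    have h3 : 0 <= (N - nn / c * (2 * a * K * p)) ^+ 2 * (c / (2 * nn)).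
      by rewrite mulr_ge0 ?sqr_ge0// ltW// divr_gt0// mulr_gt0.
    have h5 : 0 <= (2 * a * K * p) ^+ 2 * (nn / c).
      by rewrite mulr_ge0 ?sqr_ge0// ltW// divr_gt0.
    have h4 : (N - nn / c * (2 * a * K * p)) ^+ 2 * (c / (2 * nn)) =
       c / 2 * (N ^+ 2 / nn) - 2 * (a * K * p) * N +
       (2 * a * K * p) ^+ 2 * (nn / c) / 2.
      by field; rewrite !gt_eqF.
    have h6 : K2 * p ^+ 2 = (2 * a * K * p) ^+ 2 * (nn / c).
      by rewrite /K2; field; rewrite gt_eqF.
    by move: h3; rewrite h4 h6; move: h2 h5; lra.
  have cV0 : 0 <= c * V t by rewrite mulr_ge0// ltW.
  rewrite /dV; move: step1 step3 step4 step5.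
  have -> : N * (a * (eps * (b * N) + K * p)) =
    a * b * eps * N ^+ 2 + a * K * p * N by ring.
  lra.
have c20 : 0 < c / 2 by rewrite divr_gt0.
have [M hM] := power_comparison c20 VdV dVle.
(* The absolute value keeps the radicand nonnegative, since nothing is known about the sign of M. *)
exists (b * Num.sqrt (nn * `|M|)).
near=> t.
have t0 : 0 < t by near: t; apply: nbhs_pinfty_gt; exact: num_real.
have Vt : V t <= M * t `^ (- (gam *+ 2)) by near: t.
rewrite (le_trans (wx t))// -mulrA ler_wpM2l ?(ltW b0)//.
rewrite -ler_sqr ?nnegrE ?nrm1_ge0 ?mulr_ge0 ?sqrtr_ge0 ?powR_ge0//.
rewrite exprMn sqr_sqrtr; last by rewrite mulr_ge0// ltW.
have <- : t `^ (- (gam *+ 2)) = t `^ (- gam) ^+ 2.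
  by rewrite -mulNrn -mulr_natr powRrM powR_mulrn// powR_ge0.
rewrite (le_trans (V1 t))// -[leRHS]mulrA ler_pM2l// (le_trans Vt)//.
by rewrite ler_wpM2r ?powR_ge0// ler_norm.
Unshelve. all: by end_near. Qed.

End Vector.
End Derivatives.

(** * Multilinear maps *)

Section Multilinear.
Variables (R : realType) (n m : nat).
Local Notation C := R[i].
Local Notation X := 'cV[C]_n.
Implicit Types (g : {ffun 'I_m -> X} -> X) (v : {ffun 'I_m -> X}).

Lemma upd_id v (l : 'I_m) : upd v l (v l) = v.
Proof. by apply/ffunP => j; rewrite ffunE; case: eqP => [->|]. Qed.

Lemma multilinear0 g v l : multilinear g -> g (upd v l 0) = 0.
Proof.
move=> /(_ v l (-1) 0 0); rewrite scaler0 addr0 scaleN1r => ->.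
by rewrite addNr.
Qed.

Lemma multilinear_sum g v l (I : Type) (r : seq I) (a : I -> C) (x : I -> X) :
  multilinear g -> g (upd v l (\sum_(i <- r) a i *: x i)) =
  \sum_(i <- r) a i *: g (upd v l (x i)).
Proof.
move=> gl; elim: r => [|i r IH]; first by rewrite !big_nil multilinear0.
by rewrite !big_cons gl IH.
Qed.

Lemma cV_expand (x : X) : x = \sum_i x i 0 *: delta_mx i 0.
Proof.
apply/colP => j; rewrite summxE (bigD1 j)//= big1 => [|i ij].
  by rewrite addr0 !mxE !eqxx mulr1.
by rewrite !mxE eq_sym (negPf ij) mulr0.
Qed.

Lemma multilinear_eq0 g : multilinear g ->
  (forall i : {ffun 'I_m -> 'I_n}, g [ffun l => delta_mx (i l) 0] = 0) ->
  forall v, g v = 0.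
Proof.
move=> gl gb.
(* Induction on the number k of leading arguments still arbitrary: all later ones are basis vectors,
   and the last arbitrary one is expanded in the basis. *)
suff h k : (k <= m)%N -> forall v,
    (forall l : 'I_m, (k <= l)%N -> exists i, v l = delta_mx i 0) -> g v = 0.
  by move=> v; apply: (h m) => // l; rewrite leqNgt ltn_ord.
elim: k => [_ v|k IH km v] vb.
  have [i vi] := choice (fun l => vb l (leq0n _)).
  rewrite -[RHS](gb [ffun l => i l]); congr g.
  by apply/ffunP => l; rewrite !ffunE.
pose l := Ordinal km.
rewrite -(upd_id v l) (cV_expand (v l)) multilinear_sum// big1// => i _.
rewrite IH ?scaler0 ?(ltnW km)// => j; rewrite leq_eqVlt => /orP[/eqP kj|kj].
  by exists i; rewrite ffunE (_ : j == l)//; apply/eqP/val_inj.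
rewrite ffunE; case: eqP => _; first by exists i.
exact: vb.
Qed.

(** The difference of the two sides is multilinear in v and vanishes on tuples of basis vectors, so
    [multilinear_eq0] applies. *)
Lemma multilinear_expand g v : multilinear g ->
  g v = \sum_(i : {ffun 'I_m -> 'I_n})
    (\prod_l v l (i l) 0) *: g [ffun l => delta_mx (i l) 0].
Proof.
move=> gl; apply/eqP; rewrite -subr_eq0; apply/eqP.
pose e w := \sum_(i : {ffun 'I_m -> 'I_n})
    (\prod_l (w : {ffun 'I_m -> X}) l (i l) 0) *: g [ffun l => delta_mx (i l) 0].
rewrite -[LHS]/((fun w => g w - e w) v).
apply: multilinear_eq0 => [w l a x y|i].
  rewrite gl /e scalerBr scaler_sumr.
  rewrite [in LHS](eq_bigr (fun i : {ffun 'I_m -> 'I_n} =>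
      a *: ((\prod_k upd w l x k (i k) 0) *: g [ffun l => delta_mx (i l) 0]) +
      (\prod_k upd w l y k (i k) 0) *: g [ffun l => delta_mx (i l) 0])).
    by rewrite big_split/= opprD addrACA.
  move=> i _; rewrite scalerA -scalerDl; congr (_ *: _).
  have E (z : X) : \prod_k upd w l z k (i k) 0 =
      z (i l) 0 * \prod_(k | k != l) w k (i k) 0.
    rewrite (bigD1 l)//= ffunE eqxx; congr (_ * _).
    by apply: eq_bigr => k /negPf kl; rewrite ffunE kl.
  by rewrite !E !mxE mulrDl mulrA.
rewrite /e (bigD1 i)//= [X in _ - (_ + X)]big1 => [|j ji].
  rewrite addr0 big1 ?scale1r ?subrr// => l _.
  by rewrite ffunE mxE !eqxx.
have [l jl] : exists l, j l != i l.
  apply/existsP; apply: contraR ji; rewrite negb_exists => /forallP h.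
  by apply/eqP/ffunP => l; have := h l; rewrite negbK => /eqP.
by rewrite (bigD1 l)//= ffunE mxE (negPf jl) mul0r scale0r.
Qed.

(** In coordinates this is the distributive law for a product of sums. *)
Lemma multilinear_diag_sum g N (u : 'I_N -> X) : multilinear g ->
  g [ffun=> \sum_k u k] = \sum_(j : {ffun 'I_m -> 'I_N}) g [ffun l => u (j l)].
Proof.
move=> gl; rewrite multilinear_expand//.
under [RHS]eq_bigr do rewrite multilinear_expand//.
rewrite exchange_big/=; apply: eq_bigr => i _; rewrite -scaler_suml.
congr (_ *: _); under eq_bigr do rewrite ffunE summxE.
rewrite bigA_distr_bigA/=; apply: eq_bigr => j _.
by apply: eq_bigr => l _; rewrite ffunE.
Qed.

(** Telescoping a b - a' b' = a (b - b') + (a - a') b'; the bound on the product of the b i is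
    carried along because the second summand needs it. *)
Lemma normc_prodB (I : Type) (r : seq I) (a b : I -> C) (rho d : R) :
  (forall i, normc (a i) <= rho) -> (forall i, normc (b i) <= rho) ->
  (forall i, normc (a i - b i) <= d) ->
  normc (\prod_(i <- r) b i) <= rho ^+ size r /\
  normc (\prod_(i <- r) a i - \prod_(i <- r) b i) <=
    (size r)%:R * rho ^+ (size r).-1 * d.
Proof.
move=> ha hb hd; elim: r => [|x r [IH1 IH2]].
  by rewrite !big_nil subrr normc0 normc1 !mul0r.
have rho0 : 0 <= rho by rewrite (le_trans (normc_ge0 _) (ha x)).
have d0 : 0 <= d by rewrite (le_trans (normc_ge0 _) (hd x)).
rewrite !big_cons; split.
  by rewrite normcM /= exprS ler_pM ?normc_ge0.
set p := \prod_(i <- r) a i in IH2 *; set q := \prod_(i <- r) b i in IH1 IH2 *.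
rewrite (_ : _ - _ = a x * (p - q) + (a x - b x) * q); last by ring.
rewrite (le_trans (le_normcD _ _))// !normcM /=.
have h1 : normc (a x) * normc (p - q) <= rho * ((size r)%:R * rho ^+ (size r).-1 * d).
  by rewrite ler_pM ?normc_ge0.
have h2 : normc (a x - b x) * normc q <= d * rho ^+ size r.
  by rewrite ler_pM ?normc_ge0.
rewrite (le_trans (lerD h1 h2))// le_eqVlt; apply/orP; left; apply/eqP.
have -> : rho * ((size r)%:R * rho ^+ (size r).-1 * d) =
    (size r)%:R * rho ^+ size r * d.
  by case: (size r) => [|s] /=; rewrite ?mul0r ?mulr0// exprS; ring.
rewrite -natr1; ring.
Qed.

(** On the ball of radius r <= 1 the diagonal map has a Lipschitz constant at most K r^(m-1), and m
    >= 2 leaves a factor r to make it small. *)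
Lemma multilinear_diag_small g (eps : R) : (2 <= m)%N -> multilinear g ->
  0 < eps -> exists r, 0 < r /\ forall x y : X, nrm1 x <= r -> nrm1 y <= r ->
    nrm1 (g [ffun=> x] - g [ffun=> y]) <= eps * nrm1 (x - y).
Proof.
move=> m2 gl eps0.
pose c (i : {ffun 'I_m -> 'I_n}) := nrm1 (g [ffun l => delta_mx (i l) 0]).
pose K := 1 + m%:R * \sum_i c i.
have s0 : 0 <= \sum_i c i by apply: sumr_ge0 => i _; exact: nrm1_ge0.
have K1 : 1 <= K by rewrite lerDl mulr_ge0.
have K0 : 0 < K by rewrite (lt_le_trans ltr01).
exists (Num.min 1 (eps / K)); rewrite lt_min ltr01 divr_gt0//; split=> // x y.
set r := Num.min 1 (eps / K) => xr yr.
have r1 : r <= 1 by rewrite ge_min lexx.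
have reps : r * K <= eps by rewrite -ler_pdivlMr// ge_min lexx orbT.
have r0 : 0 <= r by rewrite (le_trans (nrm1_ge0 x)).
rewrite (multilinear_expand _ gl) (multilinear_expand [ffun=> y] gl) -sumrB.
rewrite (le_trans (nrm1_sum _ _ _))//.
have step (i : {ffun 'I_m -> 'I_n}) : nrm1
    ((\prod_l [ffun=> x] l (i l) 0) *: g [ffun l => delta_mx (i l) 0] -
     (\prod_l [ffun=> y] l (i l) 0) *: g [ffun l => delta_mx (i l) 0])
    <= m%:R * c i * (r * nrm1 (x - y)).
  rewrite -scalerBl nrm1Z -/(c i) [leLHS]mulrC [m%:R * _]mulrC -mulrA.
  rewrite ler_wpM2l ?nrm1_ge0//.
  have [||l|_] := @normc_prodB _ (index_enum 'I_m)
    (fun l => [ffun=> x] l (i l) 0) (fun l => [ffun=> y] l (i l) 0) r (nrm1 (x - y)).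
  - by move=> l; rewrite ffunE (le_trans (normc_le_nrm1 _ _)).
  - by move=> l; rewrite ffunE (le_trans (normc_le_nrm1 _ _)).
  - have := normc_le_nrm1 (x - y) (i l); rewrite !ffunE !mxE; exact.
  rewrite [index_enum _]unlock -enumT size_enum_ord => /le_trans; apply.
  rewrite -mulrA ler_wpM2l// ler_wpM2r ?nrm1_ge0//.
  rewrite -[leRHS]expr1; apply: ler_wiXn2l => //.
  by case: m m2 => [|[]].
rewrite (le_trans (ler_sum _ (fun i _ => step i)))//.
rewrite -mulr_suml mulrA ler_wpM2r ?nrm1_ge0//.
rewrite (le_trans _ reps)// mulrC ler_wpM2l// -mulr_sumr /K.
by rewrite lerDr.
Qed.

End Multilinear.

(** * Closure properties of the power classes *)

Section ZPowers.
Variable R : realType.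
Local Notation C := R[i].

Lemma cpowD (t : R) (a b : C) : cpow t (a + b) = cpow t a * cpow t b.
Proof. by rewrite /cpow mulrDl cexpD. Qed.

Lemma cpow0 (t : R) : cpow t 0 = 1.
Proof. by rewrite /cpow mul0r cexp0. Qed.

Lemma cpowN1 (t : R) : 0 < t -> cpow t (-1) = (t^-1)%:C.
Proof.
move=> t0; rewrite /cpow mulN1r /cexp /= oppr0 cos0 sin0.
by rewrite -lnV ?posrE// lnK ?posrE ?invr_gt0// mulr1.
Qed.

Lemma zpowD k (z : 'I_k.+2 -> R) a b : zpow z (a + b) = zpow z a * zpow z b.
Proof. by rewrite /zpow -big_split; apply: eq_bigr => j _; rewrite mxE cpowD. Qed.

Lemma zpow0 k (z : 'I_k.+2 -> R) : zpow z 0 = 1.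
Proof. by rewrite /zpow big1// => j _; rewrite mxE cpow0. Qed.

Lemma calE0P k mu (a : 'rV[C]_k.+2) : calE 0 mu a <->
  complex.Re (a 0 ord0) = 0 /\ complex.Re (a 0 (lift ord0 ord0)) = mu.
Proof.
split=> [[h1 h2]|[h1 h2]]; first by split; [apply: h1|apply: h2].
split=> j; rewrite /lvl; case: j => [[|[|j]] jk] //= h.
- by rewrite -h1; congr (complex.Re (a 0 _)); exact: val_inj.
- by rewrite -h2; congr (complex.Re (a 0 _)); exact: val_inj.
Qed.

Lemma calE0D k mu nu (a b : 'rV[C]_k.+2) :
  calE 0 mu a -> calE 0 nu b -> calE 0 (mu + nu) (a + b).
Proof.
move=> /calE0P[a1 a2] /calE0P[b1 b2]; apply/calE0P.
by rewrite !mxE !raddfD/= a1 a2 b1 b2 addr0.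
Qed.

(** The exponent of the weight 1 / (z_0 ... z_j) in [opR], which thus becomes a shift of
    exponents. *)
Definition inv_exponent k (j : 'I_k.+2) : 'rV[C]_k.+2 :=
  \row_i (if (0 <= lvl i <= lvl j)%R then -1 else 0).

Lemma calE_inv_exponent k (j : 'I_k.+2) : (0 <= lvl j)%R ->
  calE 0 (-1) (inv_exponent j).
Proof.
move=> j0; apply/calE0P; rewrite !mxE /lvl /=.
by split => //; move: j0; rewrite /lvl => ->.
Qed.

Lemma zpow_inv_exponent k (z : 'I_k.+2 -> R) j : orthant z ->
  zpow z (inv_exponent j) = (\prod_(i < k.+2 | (0 <= lvl i <= lvl j)%R) (z i)^-1)%:C.
Proof.
move=> z0; rewrite /zpow rmorph_prod big_mkcond/= [RHS]big_mkcond/=.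
by apply: eq_bigr => i _; rewrite mxE; case: ifP => _; rewrite ?cpow0// cpowN1.
Qed.

Section PowerSums.
Variable X : lmodType C.

(** Lists may repeat exponents, so sums and products of power sums are a concatenation and a list of
    pairs; [lterms] merges the repetitions afterwards. *)
Definition lsum k (s : seq ('rV[C]_k.+2 * X)) (z : 'I_k.+2 -> R) : X :=
  \sum_(x <- s) zpow z x.1 *: x.2.

Definition lrep k (s : seq ('rV[C]_k.+2 * X)) (p : gfun X k) : Prop :=
  forall z, orthant z -> p z = lsum s z.

Lemma big_collect (I : choiceType) (V : nmodType) (T : choiceType) (r : seq I)
    (h : I -> T) (F : T -> I -> V) :
  \sum_(a <- [fset h x | x in r]%fset) \sum_(x <- r | h x == a) F a x =
  \sum_(x <- r) F (h x) x.
Proof.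
rewrite (exchange_big_dep xpredT)//=; apply: eq_big_seq => x xr.
rewrite big_mkcond (bigD1_seq (h x)) ?fset_uniq//=; last first.
  by apply/imfsetP; exists x.
by rewrite eqxx big1 ?addr0// => a; rewrite eq_sym => /negPf ->.
Qed.

Definition lterms k (s : seq ('rV[C]_k.+2 * X)) : terms X k :=
  ([fset x.1 | x in s]%fset, fun a => \sum_(x <- s | x.1 == a) x.2).

Lemma lrep_represents k s (p : gfun X k) : lrep s p -> represents (lterms s) p.
Proof.
move=> h z z0; rewrite h//= /lsum.
under [RHS]eq_bigr do rewrite scaler_sumr.
by rewrite (big_collect _ fst (fun a x => zpow z a *: x.2)).
Qed.

Lemma scrP_seqP m k mu (p : gfun X k) : scrP_m m mu p <->
  exists s : seq ('rV[C]_k.+2 * X), (forall x, x \in s -> calE m mu x.1) /\ lrep s p.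
Proof.
split=> [[c [cE cp]]|[s [sE sp]]].
  exists [seq (a, c.2 a) | a <- c.1]; split=> [x /mapP[a /cE ? ->]//|z z0].
  by rewrite cp// /lsum big_map.
exists (lterms s); split; last exact: lrep_represents.
by move=> a /imfsetP[x /= /sE ? ->].
Qed.

(** Merging repeated exponents adds coefficients, and [phi a] is additive. *)
Lemma termwise_seq k (phi : 'rV[C]_k.+2 -> X -> X) s (p : gfun X k) z :
  (forall a x y, phi a (x - y) = phi a x - phi a y) -> lrep s p ->
  termwise phi p z = \sum_(x <- s) zpow z x.1 *: phi x.1 x.2.
Proof.
move=> phiB sp; rewrite (termwiseE z phiB (lrep_represents sp)) /=.
have phi0 a : phi a 0 = 0 by rewrite -[in LHS](subrr 0) phiB subrr.
have phiN a x : phi a (- x) = - phi a x by rewrite -sub0r phiB phi0 sub0r.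
have phiD a : {morph phi a : x y / x + y}.
  by move=> x y; rewrite -[y in LHS]opprK phiB phiN opprK.
under eq_bigr do rewrite (big_morph _ (phiD _) (phi0 _)) scaler_sumr.
by rewrite (big_collect _ fst (fun a x => zpow z a *: phi a x.2)).
Qed.

Lemma scrP_ext m k mu (p q : gfun X k) : (forall z, orthant z -> p z = q z) ->
  scrP_m m mu p -> scrP_m m mu q.
Proof. by move=> pq [c [cE cp]]; exists c; split=> // z z0; rewrite -pq// cp. Qed.

Lemma scrP0 m k mu : scrP_m m mu ((fun=> 0) : gfun X k).
Proof.
apply/scrP_seqP; exists [::]; split=> // z _.
by rewrite /lsum big_nil.
Qed.

Lemma scrPD m k mu (p q : gfun X k) :
  scrP_m m mu p -> scrP_m m mu q -> scrP_m m mu (fun z => p z + q z).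
Proof.
move=> /scrP_seqP[s [sE sp]] /scrP_seqP[s' [sE' sq]]; apply/scrP_seqP.
exists (s ++ s'); split=> [x|z z0].
  by rewrite mem_cat => /orP[/sE|/sE'].
by rewrite /lsum big_cat/= sp// sq.
Qed.

Lemma scrP_sum m k mu (I : Type) (r : seq I) (P : pred I) (p : I -> gfun X k) :
  (forall i, P i -> scrP_m m mu (p i)) ->
  scrP_m m mu (fun z => \sum_(i <- r | P i) p i z).
Proof.
move=> h; elim: r => [|i r IH].
  by apply: scrP_ext (scrP0 _ _ _) => z _; rewrite big_nil.
have [Pi|Pi] := boolP (P i); last first.
  by apply: scrP_ext IH => z _; rewrite big_cons (negPf Pi).
by apply: scrP_ext (scrPD (h i Pi) IH) => z _; rewrite big_cons Pi.
Qed.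

Lemma scrP_termwise m k mu (phi : 'rV[C]_k.+2 -> X -> X) (p : gfun X k) :
  (forall a x y, phi a (x - y) = phi a x - phi a y) -> scrP_m m mu p ->
  scrP_m m mu (termwise phi p).
Proof.
move=> phiB /scrP_seqP[s [sE sp]]; apply/scrP_seqP.
exists [seq (x.1, phi x.1 x.2) | x <- s]; split=> [y /mapP[x /sE ? ->]//|z _].
by rewrite (termwise_seq z phiB sp) /lsum big_map.
Qed.

Lemma scrPN m k mu (p : gfun X k) :
  scrP_m m mu p -> scrP_m m mu (fun z => - p z).
Proof.
move=> /scrP_seqP[s [sE sp]]; apply/scrP_seqP.
exists [seq (x.1, - x.2) | x <- s]; split=> [y /mapP[x /sE ? ->]//|z z0].
rewrite sp// /lsum big_map -sumrN; apply: eq_bigr => x _.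
by rewrite scalerN.
Qed.

(** Each weight contains z_0 exactly to the power -1 and no power of e^t; its logarithmic factors do
    not affect the class. *)
Lemma scrP_opR k mu (p : gfun X k) :
  scrP_m 0 mu p -> scrP_m 0 (mu - 1) (opR p).
Proof.
move=> hp; apply: scrP_sum => j j0.
have /scrP_seqP[s [sE sp]] : scrP_m 0 mu (opM j p).
  by apply: scrP_termwise => // a x y; rewrite scalerBr.
apply/scrP_seqP; exists [seq (x.1 + inv_exponent j, x.2) | x <- s].
split=> [y /mapP[x /sE xE ->]|z z0].
  by apply: calE0D => //; exact: calE_inv_exponent.
rewrite -zpow_inv_exponent// sp// /lsum big_map scaler_sumr.
by apply: eq_bigr => x _; rewrite scalerA zpowD mulrC.
Qed.

Lemma scrP_widen k k' mu (p : gfun X k) : (k <= k')%N ->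
  scrP_m 0 mu p -> scrP_m 0 mu (widen_gfun (k' := k') p).
Proof.
move=> kk' /scrP_seqP[s [sE sp]]; apply/scrP_seqP.
pose pad (a : 'rV[C]_k.+2) : 'rV[C]_k'.+2 :=
  \row_j (if (j < k.+2)%N then a 0 (inord j) else 0).
have zpad (z : 'I_k'.+2 -> R) a :
    zpow z (pad a) = zpow (fun j : 'I_k.+2 => z (inord j)) a.
  have kk2 : (k.+2 <= k'.+2)%N by [].
  rewrite /zpow [RHS](eq_bigr (fun j : 'I_k.+2 =>
    cpow (z (inord j)) (a 0 (inord j)))); last by move=> j _; rewrite inord_val.
  rewrite (big_ord_widen k'.+2
    (fun j => cpow (z (inord j)) (a 0 (inord j))) kk2) [RHS]big_mkcond/=.
  apply: eq_bigr => j _; rewrite mxE; case: ifP => jk; rewrite ?cpow0//.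
  by rewrite inord_val.
exists [seq (pad x.1, x.2) | x <- s]; split=> [y /mapP[x /sE xE ->]|z z0].
  move/calE0P: xE => [x1 x2]; apply/calE0P; rewrite !mxE /=.
  split; [rewrite -x1|rewrite -x2]; congr (complex.Re (x.1 0 _)); apply: val_inj;
    by rewrite /= inordK.
rewrite /widen_gfun sp; last by move=> j; exact: z0.
by rewrite /lsum big_map; apply: eq_bigr => x _; rewrite zpad.
Qed.

Lemma scrP_cst k (x : X) : scrP_m 0 0 ((fun=> x) : gfun X k).
Proof.
apply/scrP_seqP; exists [:: (0, x)]; split=> [y|z _].
  by rewrite inE => /eqP ->; apply/calE0P; rewrite !mxE.
by rewrite /lsum big_seq1 zpow0 scale1r.
Qed.

End PowerSums.

(** Scalar functions are taken with values in [C^o], so that coordinates and their products belong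
    to the same family of classes. *)
Lemma scrP_scale (X : lmodType C) k mu nu (a : gfun C^o k) (p : gfun X k) :
  scrP_m 0 mu a -> scrP_m 0 nu p -> scrP_m 0 (mu + nu) (fun z => a z *: p z).
Proof.
move=> /scrP_seqP[s [sE sp]] /scrP_seqP[s' [sE' sq]]; apply/scrP_seqP.
exists [seq (x.1 + y.1, x.2 *: y.2) | x <- s, y <- s']; split=> [w|z z0].
  by move=> /allpairsP[[x y] /= [/sE xs /sE' ys ->]]; exact: calE0D.
rewrite sp// sq// /lsum big_allpairs_dep/= scaler_suml; apply: eq_bigr => x _.
rewrite scaler_sumr; apply: eq_bigr => y _.
by rewrite !scalerA zpowD /GRing.scale/= -!mulrA [x.2 * _]mulrC mulrA.
Qed.

End ZPowers.

(** * Vector-valued power sums: multilinear maps and the inverse of A + [opM ord0] *)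

Section VectorPowerSums.
Variables (R : realType) (n : nat).
Local Notation C := R[i].
Local Notation X := 'cV[C]_n.

Lemma scrP_prod k (I : Type) (r : seq I) (mu : I -> R) (a : I -> gfun C^o k) :
  (forall i, scrP_m 0 (mu i) (a i)) ->
  scrP_m 0 (\sum_(i <- r) mu i) (fun z => \prod_(i <- r) a i z : C^o).
Proof.
move=> h; elim: r => [|i r IH].
  by rewrite big_nil; apply: scrP_ext (scrP_cst k (1 : C^o)) => z _; rewrite big_nil.
by rewrite big_cons; apply: scrP_ext (scrP_scale (h i) IH) => z _; rewrite big_cons.
Qed.

Lemma scrP_coord k mu (p : gfun X k) i :
  scrP_m 0 mu p -> scrP_m 0 mu (fun z => p z i 0 : C^o).
Proof.
move=> /scrP_seqP[s [sE sp]]; apply/scrP_seqP.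
exists [seq (x.1, (x.2 : X) i 0 : C^o) | x : 'rV[C]_k.+2 * X <- s].
split=> [y /mapP[x /sE ? ->]//|z z0].
by rewrite sp// /lsum big_map summxE; apply: eq_bigr => x _; rewrite mxE.
Qed.

(** Expansion in the basis reduces this to products of scalar coordinates times constant vectors. *)
Lemma scrP_multilinear k m (g : {ffun 'I_m -> X} -> X) (mu : 'I_m -> R)
    (p : 'I_m -> gfun X k) : multilinear g ->
  (forall l, scrP_m 0 (mu l) (p l)) ->
  scrP_m 0 (\sum_l mu l) (fun z => g [ffun l => p l z]).
Proof.
move=> gl h.
apply: (@scrP_ext _ _ _ _ _ (fun z => \sum_(i : {ffun 'I_m -> 'I_n})
    (\prod_l p l z (i l) 0) *: g [ffun l => delta_mx (i l) 0])).
  move=> z _; rewrite [RHS]multilinear_expand//; apply: eq_bigr => i _.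
  by congr (_ *: _); apply: eq_bigr => l _; rewrite ffunE.
apply: scrP_sum => i _; rewrite -[\sum_l mu l]addr0.
apply: scrP_scale; last exact: scrP_cst.
by apply: scrP_prod => l; exact: scrP_coord.
Qed.

Lemma scrP_opZ k mu (A : 'M[C]_n) (p : gfun X k) :
  scrP_m 0 mu p -> scrP_m 0 mu (opZ A p).
Proof. by apply: scrP_termwise => a x y; rewrite mulmxBr. Qed.

(** A kernel vector would make -a, whose real part is 0, an eigenvalue of A. *)
Lemma shift_unitmx (A : 'M[C]_n) (a : C) :
  (forall b : C, eigenvalue A b -> 0 < complex.Re b) -> complex.Re a = 0 ->
  A + a%:M \in unitmx.
Proof.
move=> specA a0; rewrite unitmxE unitfE; apply/negP => /eqP/eqP/det0P[v v0 vA].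
have : 0 < complex.Re (- a).
  apply: specA; apply/eigenvalueP; exists v => //.
  move/eqP: vA; rewrite mulmxDr mul_mx_scalar addr_eq0 => /eqP ->.
  by rewrite scaleNr.
by rewrite raddfN/= a0 oppr0 ltxx.
Qed.

Lemma opZK k mu (A : 'M[C]_n) (p : gfun X k) z :
  (forall b : C, eigenvalue A b -> 0 < complex.Re b) ->
  scrP_m 0 mu p -> orthant z ->
  A *m opZ A p z + opM ord0 (opZ A p) z = p z.
Proof.
move=> specA /scrP_seqP[s [sE sp]] z0.
have phiB (a : 'rV[C]_k.+2) (x y : X) : invmx (A + (a 0 ord0)%:M) *m (x - y) =
    invmx (A + (a 0 ord0)%:M) *m x - invmx (A + (a 0 ord0)%:M) *m y.
  by rewrite mulmxBr.
pose s' := [seq (x.1, invmx (A + (x.1 0 ord0)%:M) *m x.2) |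
  x : 'rV[C]_k.+2 * X <- s].
have rs' : lrep s' (opZ A p).
  by move=> w _; rewrite /opZ (termwise_seq w phiB sp) /lsum big_map.
rewrite /opM (termwise_seq z _ rs') => [|a x y]; last by rewrite scalerBr.
rewrite rs'// /lsum !big_map/= mulmx_sumr -big_split/= sp// /lsum.
apply: eq_big_seq => x /sE/calE0P[x0 _].
rewrite -scalemxAr -scalerDr; congr (_ *: _).
by rewrite -mul_scalar_mx -mulmxDl mulKVmx// shift_unitmx.
Qed.

End VectorPowerSums.

(** * Iterated logarithms *)

Section IteratedLogarithms.
Variable R : realType.
Local Notation C := R[i].

Lemma iter_ln_gt (j : nat) (M : R) : \forall t \near +oo, M < iter j (@ln R) t.
Proof.
elim: j M => [|j IH] M; first by apply: nbhs_pinfty_gt; exact: num_real.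
have := IH (expR M); apply: filterS => t /= h.
by rewrite -[M]expRK ltr_ln ?posrE ?expR_gt0// (lt_trans (expR_gt0 M)).
Qed.

(** With s the square root of t, ln t = 2 ln s <= 2 s, and 2 <= eps s once t exceeds 4 / eps^2. *)
Lemma ln_le_eps (eps : R) : 0 < eps -> \forall t \near +oo, ln t <= eps * t.
Proof.
move=> e0; near=> t.
have te : 4 / eps ^+ 2 < t by near: t; apply: nbhs_pinfty_gt; exact: num_real.
have t0 : 0 < t by rewrite (lt_trans _ te)// divr_gt0// exprn_gt0.
set s := Num.sqrt t.
have ts : t = s ^+ 2 by rewrite sqr_sqrtr// ltW.
have s0 : 0 < s by rewrite sqrtr_gt0.
have se : 2 < eps * s.
  have h : 0 <= eps * s by rewrite mulr_ge0 ?ltW.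
  rewrite -ltr_sqr ?nnegrE// exprMn -ts.
  by move: te; rewrite ltr_pdivrMr ?exprn_gt0// mulrC; lra.
rewrite {1}ts lnXn// mulr2n; have := ln_sublinear s0 => ls.
rewrite ts expr2 mulrA.
have : 2 * s <= eps * s * s by rewrite ler_wpM2r ?(ltW s0)// ltW.
by move: ls; lra.
Unshelve. all: by end_near. Qed.

(** The double logarithm is covered by [ln_le_eps] at ln t, the further ones by ln x < x. *)
Lemma iter_ln_small (j : nat) (eps : R) : 0 < eps ->
  \forall t \near +oo, `|iter j.+2 (@ln R) t| <= eps * ln t.
Proof.
move=> e0; suff : \forall t \near +oo, 0 <= iter j.+2 (@ln R) t <= eps * ln t.
  by apply: filterS => t /andP[h]; rewrite ger0_norm.
elim: j => [|j IH].
  have [M [_ hM]] := ln_le_eps e0; near=> t; apply/andP; split.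
    by apply/ltW; near: t; exact: iter_ln_gt 2 0.
  by apply: hM; near: t; exact: iter_ln_gt 1 M.
near=> t; apply/andP; split.
  by apply/ltW; near: t; exact: iter_ln_gt j.+3 0.
have h0 : 0 < iter j.+2 (@ln R) t by near: t; exact: iter_ln_gt.
have /andP[_] : 0 <= iter j.+2 (@ln R) t <= eps * ln t by near: t.
by apply: le_trans; rewrite iterS ltW// ln_sublinear.
Unshelve. all: by end_near. Qed.

Lemma orthant_Lhat (k : nat) : \forall t \near +oo, orthant (@Lhat R k t).
Proof.
suff : \forall t \near +oo, forall i : 'I_k.+1, 0 < iter i (@ln R) t.
  apply: filterS => t h [[|j] jk] /=; first exact: expR_gt0.
  exact: (h (Ordinal (jk : (j < k.+1)%N))).
by apply: filter_forall => i; exact: iter_ln_gt.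
Qed.

(** The coordinate at position j has logarithm [iter j ln t], also for j = 0, where it is e^t. Size
    and derivative of a monomial are both read off from this single exponential. *)
Lemma zpow_Lhat k t (a : 'rV[C]_k.+2) :
  zpow (@Lhat R k t) a = cexp (\sum_(j < k.+2) a 0 j * (iter j (@ln R) t)%:C).
Proof.
rewrite (big_morph _ (@cexpD R) (@cexp0 R)); apply: eq_bigr => j _.
rewrite /cpow; congr (cexp (_ * _%:C)).
by rewrite /Lhat; case: j => [[|j] jk] //=; rewrite expRK.
Qed.

Lemma normc_zpow_Lhat k mu nu (a : 'rV[C]_k.+2) : calE 0 (- mu) a -> nu < mu ->
  \forall t \near +oo, normc (zpow (@Lhat R k t) a) <= t `^ (- nu).
Proof.
move=> /calE0P[a0 a1] numu.
pose S := \sum_(j < k) `|complex.Re (a 0 (lift ord0 (lift ord0 j)))|.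
have S0 : 0 <= S by apply: sumr_ge0.
(* All logarithms beyond the first contribute at most S eps ln t to the exponent, which fits into
   the gap mu - nu. *)
pose eps := (mu - nu) / (1 + S).
have S1 : 0 < 1 + S by rewrite ltr_pwDl.
have e0 : 0 < eps by rewrite divr_gt0// subr_gt0.
near=> t.
have t0 : 0 < t by near: t; apply: nbhs_pinfty_gt; exact: num_real.
have lt0 : 0 < ln t by near: t; exact: iter_ln_gt 1 0.
have small (j : 'I_k) : `|iter j.+2 (@ln R) t| <= eps * ln t.
  move: j; near: t; apply: filter_forall => j; exact: iter_ln_small.
rewrite zpow_Lhat normc_cexp /powR gt_eqF// ler_expR.
rewrite raddf_sum/= 2!big_ord_recl/=.
rewrite !ReM/= a0 a1 !mulr0 mul0r !subr0 add0r.
rewrite -lerBrDl -mulrBl opprK addrC.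
apply: (@le_trans _ _ (\sum_(j < k)
    `|complex.Re (a 0 (lift ord0 (lift ord0 j)))| * (eps * ln t))).
  apply: ler_sum => j _; rewrite ReM/= mulr0 subr0.
  by rewrite (le_trans (ler_norm _))// normrM ler_wpM2l// small.
rewrite -mulr_suml -/S mulrA ler_pM2r//.
rewrite /eps mulrA ler_pdivrMr// mulrC ler_wpM2l ?subr_ge0 ?(ltW numu)//.
by rewrite lerDr.
Unshelve. all: by end_near. Qed.

Lemma is_derive_iter_ln (j : nat) (t : R) :
  (forall i, (i < j)%N -> 0 < iter i (@ln R) t) ->
  is_derive t (1 : R) (iter j (@ln R)) (\prod_(i < j) (iter i (@ln R) t)^-1).
Proof.
elim: j => [_|j IH h]; first by rewrite big_ord0; exact: is_derive_id.
rewrite big_ord_recr/= mulrC -[iter j.+1 _]/(@ln R \o iter j (@ln R)).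
apply: is_derive1_comp; first by apply: is_derive1_ln; exact: h.
by apply: IH => i ij; apply: h; exact: ltnW.
Qed.

Lemma lvl_lift0 k (i : 'I_k.+1) : lvl (lift ord0 i) = i%:Z.
Proof. by rewrite /lvl /= /bump/= add1n -addn1 PoszD addrK. Qed.

(** Level i sits at position i + 1, so the levels from 0 to [lvl j] give j factors, and none for
    e^t. *)
Lemma prod_Lhat k (t : R) (j : 'I_k.+2) :
  \prod_(i < k.+2 | (0 <= lvl i <= lvl j)%R) (@Lhat R k t i)^-1 =
  \prod_(i < j) (iter i (@ln R) t)^-1.
Proof.
have jk : (j <= k.+1)%N by rewrite -ltnS.
rewrite (big_ord_widen _ (fun i => (iter i (@ln R) t)^-1) jk).
rewrite [LHS]big_mkcond big_ord_recl /= mul1r [RHS]big_mkcond/=.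
apply: eq_bigr => i _; rewrite -[Lhat t (lift ord0 i)]/(iter i (@ln R) t).
by rewrite lvl_lift0 /lvl lerBrDr -[1]/(1%:Z) -PoszD lez_nat addn1.
Qed.

Lemma cderive_zpow_Lhat k (a : 'rV[C]_k.+2) (t : R) : orthant (@Lhat R k t) ->
  cderive (fun s => zpow (@Lhat R k s) a) t (zpow (@Lhat R k t) a *
    \sum_(j < k.+2) a 0 j * (\prod_(i < j) (iter i (@ln R) t)^-1)%:C).
Proof.
move=> tk; under eq_fun do rewrite zpow_Lhat.
rewrite zpow_Lhat; apply: cderive_cexp; apply: cderive_sum => j _.
apply: cderiveZ; apply: cderive_real; apply: is_derive_iter_ln => i ij.
have ik : (i.+1 < k.+2)%N by rewrite ltnS (leq_trans ij)// -ltnS.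
exact: (tk (Ordinal ik)).
Qed.

(** * Decay rates up to an arbitrarily small loss *)

Section PowerO.
Variable n : nat.
Local Notation X := 'cV[C]_n.

Definition powO (mu : R) (u : R -> X) : Prop := forall nu, nu < mu ->
  exists K, \forall t \near +oo, nrm1 (u t) <= K * t `^ (- nu).

Lemma powOW mu nu u : nu <= mu -> powO mu u -> powO nu u.
Proof. by move=> h uO a anu; apply: uO; rewrite (lt_le_trans anu). Qed.

Lemma powO_eq mu u v : (\forall t \near +oo, u t = v t) -> powO mu u -> powO mu v.
Proof.
move=> uv h nu /h[K hK]; exists K.
by apply: filterS2 uv hK => t ->.
Qed.

Lemma powO0 mu : powO mu (fun=> 0).
Proof. by move=> nu _; exists 0; apply: nearW => t; rewrite nrm1_0 mul0r. Qed.

Lemma powOD mu u v : powO mu u -> powO mu v -> powO mu (fun t => u t + v t).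
Proof.
move=> uO vO nu numu; have [K hK] := uO _ numu; have [L hL] := vO _ numu.
exists (K + L); apply: filterS2 hK hL => t h1 h2.
by rewrite mulrDl (le_trans (nrm1D _ _))// lerD.
Qed.

Lemma powON mu u : powO mu u -> powO mu (fun t => - u t).
Proof. by move=> h nu /h[K hK]; exists K; apply: filterS hK => t; rewrite nrm1N. Qed.

Lemma powO_sum mu (I : Type) (r : seq I) (P : pred I) (u : I -> R -> X) :
  (forall i, P i -> powO mu (u i)) ->
  powO mu (fun t => \sum_(i <- r | P i) u i t).
Proof.
move=> h; elim: r => [|i r IH].
  apply: (@powO_eq _ (fun=> 0)); last exact: powO0.
  by apply: nearW => t; rewrite big_nil.
have [Pi|Pi] := boolP (P i); last first.
  apply: (@powO_eq _ (fun t => \sum_(i <- r | P i) u i t)) => //.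
  by apply: nearW => t; rewrite big_cons (negPf Pi).
apply: (@powO_eq _ (fun t => u i t + \sum_(i <- r | P i) u i t)).
  by apply: nearW => t; rewrite big_cons Pi.
by apply: powOD => //; exact: h.
Qed.

Lemma scrP_powO k mu (p : gfun X k) : scrP_m 0 (- mu) p ->
  powO mu (fun t => p (@Lhat R k t)).
Proof.
move=> /scrP_seqP[s [sE sp]].
apply: (@powO_eq _ (fun t => lsum s (@Lhat R k t))).
  by have := orthant_Lhat k; apply: filterS => t /sp.
rewrite /lsum => nu numu; elim: s sE {sp} => [|x s IH] sE.
  by exists 0; apply: nearW => t; rewrite big_nil nrm1_0 mul0r.
have [K hK] : exists K, \forall t \near +oo,
    nrm1 (\sum_(x <- s) zpow (@Lhat R k t) x.1 *: x.2) <= K * t `^ (- nu).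
  by apply: IH => y ys; apply: sE; rewrite inE ys orbT.
have hx := normc_zpow_Lhat (sE x (mem_head _ _)) numu.
exists (nrm1 x.2 + K); apply: filterS2 hK hx => t h1 h2.
rewrite big_cons (le_trans (nrm1D _ _))// mulrDl lerD// nrm1Z mulrC.
by rewrite ler_wpM2l ?nrm1_ge0.
Qed.

Lemma vderive_near (u v : R -> X) t d : (\forall s \near t, u s = v s) ->
  vderive u t d -> vderive v t d.
Proof.
move=> uv h i; have [h1 h2] := h i.
by split; [apply: near_eq_is_derive h1|apply: near_eq_is_derive h2];
  rewrite ?oner_eq0//; apply: filterS uv => s ->.
Qed.

Lemma vderive_scrP k mu (p : gfun X k) : scrP_m 0 mu p ->
  \forall t \near +oo, vderive (fun s => p (@Lhat R k s)) t
    (opM ord0 p (@Lhat R k t) + opR p (@Lhat R k t)).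
Proof.
move=> /scrP_seqP[s [sE sp]]; have [T [_ hT]] := orthant_Lhat k.
near=> t.
have Tt : T < t by near: t; apply: nbhs_pinfty_gt; exact: num_real.
(* The representation of p is valid on the orthant only, hence in a neighbourhood of t but not for
   all arguments. *)
apply: (@vderive_near (fun r => lsum s (@Lhat R k r))).
  near=> r; rewrite sp//; apply: hT.
  by near: r; exact: lt_nbhsr.
have tk := hT _ Tt.
have opME j : opM j p (@Lhat R k t) =
    \sum_(x <- s) zpow (@Lhat R k t) x.1 *: (x.1 0 j *: x.2).
  by rewrite /opM (termwise_seq _ _ sp)// => a x y; rewrite scalerBr.
have -> : opM ord0 p (@Lhat R k t) + opR p (@Lhat R k t) =
    \sum_(x <- s) (zpow (@Lhat R k t) x.1 * \sum_(j < k.+2)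
      x.1 0 j * (\prod_(i < j) (iter i (@ln R) t)^-1)%:C) *: x.2.
  rewrite /opR.
  under eq_bigr do rewrite prod_Lhat opME.
  rewrite opME [X in _ + X]big_mkcond [X in _ + X]big_ord_recl/= add0r.
  under [X in _ + X]eq_bigr do rewrite scaler_sumr.
  rewrite [X in _ + X]exchange_big/= -big_split/=; apply: eq_bigr => x _.
  rewrite [X in _ = (_ * X) *: _]big_ord_recl/= big_ord0 mulr1 mulrDr scalerDl.
  rewrite scalerA; congr (_ + _).
  rewrite mulr_sumr scaler_suml; apply: eq_bigr => j _.
  by rewrite !scalerA; congr (_ *: _); ring.
rewrite /lsum; apply: vderive_sum => x _.
by apply: vderiveZr; exact: cderive_zpow_Lhat.
Unshelve. all: by end_near. Qed.

End PowerO.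
End IteratedLogarithms.

(** * Recursive construction of the coefficients *)

Section Coefficients.
Variables (R : realType) (n : nat).
Local Notation C := R[i].
Local Notation X := 'cV[C]_n.
Variables (calG : forall m, {ffun 'I_m -> X} -> X)
  (calG_lin : forall m, (2 <= m)%N -> multilinear (@calG m))
  (mu : nat -> R) (mu_gt0 : forall k, 0 < mu k)
  (mu_incr : forall j k, (j < k)%N -> mu j < mu k)
  (nk : nat -> nat) (nk_incr : forall k, (nk k <= nk k.+1)%N).

Lemma nk_mono j k : (j <= k)%N -> (nk j <= nk k)%N.
Proof. exact: (homo_leq leqnn leq_trans). Qed.

Lemma mu_ltE j k : (mu j < mu k) = (j < k)%N.
Proof. exact: (leW_mono (le_mono mu_incr)). Qed.

Lemma mu_leE j k : (mu j <= mu k) = (j <= k)%N.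
Proof. exact: (le_mono mu_incr). Qed.

(** Besides [mu (j l)] at least one more positive exponent is left. This makes the recursion for the
    coefficients well founded. *)
Lemma exponent_index_lt m (j : 'I_m -> nat) k l : (2 <= m)%N ->
  \sum_l mu (j l) = mu k -> (j l < k)%N.
Proof.
move=> m2 jk; rewrite -mu_ltE -jk (bigD1 l)//= ltrDl.
have [l' l'l] : exists l' : 'I_m, l' != l.
  have m0 : (0 < m)%N by exact: ltnW.
  have [l0|l0] := eqVneq l (Ordinal m0); last by exists (Ordinal m0); rewrite eq_sym.
  by exists (Ordinal m2); rewrite l0.
rewrite (bigD1 l')//= ltr_pwDl// sumr_ge0// => i _; exact: ltW.
Qed.

Lemma exponent_sum_ge m (j : 'I_m -> nat) : m%:R * mu 0%N <= \sum_l mu (j l).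
Proof.
apply: (@le_trans _ _ (\sum_(l < m) mu 0%N)); last first.
  by apply: ler_sum => l _; rewrite mu_leE.
by rewrite sumr_const card_ord mulr_natl.
Qed.

(** All indices are below k, hence below any N >= k; leaving N free lets the coefficients of a
    partial sum share one finite index type. *)
Lemma Gterm_inner (V : nmodType) m (H : {ffun 'I_m -> nat} -> V) k N :
  (2 <= m)%N -> (k <= N)%N ->
  \sum_(j \in [set j : {ffun 'I_m -> nat} | \sum_(l < m) mu (j l) = mu k]) H j =
  \sum_(j : {ffun 'I_m -> 'I_N} | \sum_l mu (j l) == mu k) H [ffun l => j l : nat].
Proof.
move=> m2 kN.
pose emb (j : {ffun 'I_m -> 'I_N}) : {ffun 'I_m -> nat} := [ffun l => j l : nat].
have embI : injective emb.
  move=> i j /ffunP ij; apply/ffunP => l; apply: val_inj.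
  by have := ij l; rewrite !ffunE.
pose s := [seq emb j | j : {ffun 'I_m -> 'I_N} <-
  [seq j <- enum {: {ffun 'I_m -> 'I_N}} |
    \sum_l mu ((j : {ffun 'I_m -> 'I_N}) l) == mu k]].
rewrite (_ : [set j | _] = [set` s]).
  rewrite -fsbig_seq; last by rewrite (map_inj_uniq embI) filter_uniq ?enum_uniq.
  by rewrite big_map big_filter big_enum_cond.
apply/seteqP; split=> [x /= xk|x /= /mapP[j + ->]].
  have xN l : (x l < N)%N by rewrite (leq_trans (exponent_index_lt l m2 xk)).
  apply/mapP; exists [ffun l => Ordinal (xN l)].
    rewrite mem_filter mem_enum inE andbT -xk.
    by apply/eqP; apply: eq_bigr => l _; rewrite ffunE.
  by apply/ffunP => l; rewrite !ffunE.
rewrite mem_filter => /andP[/eqP <- _].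
by apply: eq_bigr => l _; rewrite ffunE.
Qed.

(** For m > M every exponent sum is at least m [mu 0], which exceeds [mu k], so those degrees
    contribute nothing. *)
Lemma Gterm_finite (q : forall k, gfun X (nk k)) k N M z :
  (k <= N)%N -> mu k <= M%:R * mu 0%N ->
  Gterm calG mu q k z =
  \sum_(2 <= m < M.+1) \sum_(j : {ffun 'I_m -> 'I_N} | \sum_l mu (j l) == mu k)
    calG [ffun l => widen_gfun (q (j l)) z].
Proof.
move=> kN kM; rewrite /Gterm.
pose F m := \sum_(j : {ffun 'I_m -> 'I_N} | \sum_l mu (j l) == mu k)
    calG [ffun l => widen_gfun (k' := nk k) (q (j l)) z].
rewrite (_ : \sum_(m \in _) _ = \sum_(m \in [set m | (2 <= m)%N]) F m).
  rewrite -[RHS]/(\sum_(2 <= m < M.+1) F m) [RHS]fsbig_seq ?iota_uniq//.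
  apply/esym/fsbig_widen => m /=; first by rewrite mem_index_iota => /andP[].
  rewrite mem_index_iota => -[m2 /negP]; rewrite m2 -leqNgt/= => Mm.
  rewrite /F big_pred0// => j; apply/negbTE; rewrite gt_eqF//.
  rewrite (le_lt_trans kM)// (lt_le_trans _ (exponent_sum_ge _))//.
  by rewrite ltr_pM2r// ltr_nat.
apply: eq_fsbigr => m; rewrite inE/= => m2.
rewrite (Gterm_inner _ m2 kN); apply: eq_bigr => j _.
by congr calG; apply/ffunP => l; rewrite !ffunE.
Qed.

Lemma exists_multiple (r : R) : exists M : nat, (2 <= M)%N /\ r <= M%:R * mu 0%N.
Proof.
exists (2 + (Num.truncn (`|r| / mu 0%N)).+1)%N; split; first by rewrite leq_addr.
rewrite -ler_pdivrMr// (@le_trans _ _ (`|r| / mu 0%N))//.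
  by rewrite ler_wpM2r ?ler_norm// invr_ge0 ltW.
rewrite ltW// natrD ltr_wpDl// truncnS_gt//.
Qed.

Lemma Gterm_local (q q' : forall k, gfun X (nk k)) k :
  (forall j, (j < k)%N -> q j = q' j) ->
  Gterm calG mu q k = Gterm calG mu q' k.
Proof.
move=> qq'; apply/funext => z; have [M [_ kM]] := exists_multiple (mu k).
rewrite !(Gterm_finite _ _ (leqnn k) kM).
apply: eq_bigr => m _; apply: eq_bigr => j _; congr calG.
by apply/ffunP => l; rewrite !ffunE qq'.
Qed.

Lemma chi_local (q q' : forall k, gfun X (nk k)) k :
  (forall j, (j < k)%N -> q j = q' j) -> chi mu q k = chi mu q' k.
Proof.
move=> qq'; apply/funext => z; rewrite /chi.
by case: [pick l : 'I_k | _] => [l|]; rewrite ?(qq' l (ltn_ord l)).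
Qed.

Variable A : 'M[C]_n.
Variable p : forall k, gfun X (nk k).

Definition coef_step (q : forall k, gfun X (nk k)) k : gfun X (nk k) :=
  opZ A (fun z => Gterm calG mu q k z + @p k z - chi mu q k z).
Arguments coef_step q k : clear implicits.

Lemma exists_coefficients : exists q : forall k, gfun X (nk k),
  forall k, q k = coef_step q k.
Proof.
(* Whole sequences are iterated, starting from zero: after N iterations the entries of index below N
   no longer change, so the diagonal is a fixed point. *)
pose Q := fix Q N : forall k, gfun X (nk k) :=
  if N is N'.+1 then coef_step (Q N') else fun k z => 0.
have coef_stepL q q' k : (forall j, (j < k)%N -> q j = q' j) ->
    coef_step q k = coef_step q' k.
  by move=> h; rewrite /coef_step (Gterm_local h) (chi_local h).
have Qst k : forall N N', (k < N)%N -> (k < N')%N -> Q N k = Q N' k.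
  elim/ltn_ind: k => k IH [//|N] [//|N'] kN kN' /=.
  by apply: coef_stepL => j jk; apply: IH => //; exact: leq_trans jk _.
exists (fun k => Q k.+1 k) => k; apply: coef_stepL => j jk.
exact: Qst.
Qed.

Lemma scrP_Gterm (q : forall k, gfun X (nk k)) k :
  (forall j, (j < k)%N -> scrP_m 0 (- mu j) (q j)) ->
  scrP_m 0 (- mu k) (Gterm calG mu q k).
Proof.
move=> hq; have [M [_ kM]] := exists_multiple (mu k).
have h : scrP_m 0 (- mu k) ((fun z : 'I_(nk k).+2 -> R =>
    (* Repeating the range as a filter hands 2 <= m to [scrP_sum], as needed for the multilinearity
       of [calG]. *)
    \sum_(2 <= m < M.+1 | (2 <= m < M.+1)%N)
    \sum_(j : {ffun 'I_m -> 'I_k} | \sum_l mu (j l) == mu k)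
    calG [ffun l => widen_gfun (q (j l)) z]) : gfun X (nk k)).
  apply: scrP_sum => m /andP[m2 _]; apply: scrP_sum => j /eqP <-; rewrite -sumrN.
  apply: scrP_multilinear; first exact: calG_lin.
  move=> l; apply: scrP_widen; last exact: hq.
  by apply: nk_mono; exact: ltnW.
apply: scrP_ext h => z _; rewrite (Gterm_finite _ _ (leqnn k) kM).
rewrite [RHS]big_nat_cond; apply: eq_bigl => m; by rewrite andbT.
Qed.

Lemma scrP_chi (q : forall k, gfun X (nk k)) k :
  (forall j, (j < k)%N -> scrP_m 0 (- mu j) (q j)) ->
  scrP_m 0 (- mu k) (chi mu q k).
Proof.
move=> hq; rewrite /chi; case: pickP => [l /eqP <-|_]; last exact: scrP0.
rewrite opprD; apply: scrP_widen; first by apply: nk_mono; exact: ltnW.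
by apply: scrP_opR; exact: hq.
Qed.

Lemma scrP_rhs (q : forall k, gfun X (nk k)) k :
  (forall j, (j < k)%N -> scrP_m 0 (- mu j) (q j)) ->
  scrP_m 0 (- mu k) (@p k) ->
  scrP_m 0 (- mu k) (fun z => Gterm calG mu q k z + @p k z - chi mu q k z).
Proof.
move=> hq hp; apply: scrPD; last by apply: scrPN; exact: scrP_chi.
by apply: scrPD => //; exact: scrP_Gterm.
Qed.

Lemma scrP_coefficients (q : forall k, gfun X (nk k)) :
  (forall k, scrP_m 0 (- mu k) (@p k)) -> (forall k, q k = coef_step q k) ->
  forall k, scrP_m 0 (- mu k) (q k).
Proof.
move=> hp hq; elim/ltn_ind => k IH; rewrite hq.
by apply: scrP_opZ; exact: scrP_rhs.
Qed.

End Coefficients.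

Arguments coef_step {R n} calG mu {nk} A p q k.

(** * Remainder estimates *)

Section Remainders.
Variables (R : realType) (n : nat).
Local Notation C := R[i].
Local Notation X := 'cV[C]_n.

Lemma bigO_powO (mu nu : R) (u : R -> X) : mu <= nu ->
  bigO_pinfty u (fun t => t `^ (- nu)) -> powO mu u.
Proof.
move=> munu [T [K [T0 K0 h]]] a amu; exists (n%:R * K).
near=> t.
have Tt : T <= t by near: t; apply: nbhs_pinfty_ge; exact: num_real.
have t1 : 1 <= t by near: t; apply: nbhs_pinfty_ge; exact: num_real.
rewrite (le_trans (nrm1_le_enorm _))// -mulrA ler_wpM2l//.
rewrite (le_trans (h _ Tt))// ler_wpM2l ?(ltW K0)//.
by rewrite ler_powR// lerN2 (le_trans (ltW amu)).
Unshelve. all: by end_near. Qed.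

Lemma powO_bigO (mu nu : R) (u : R -> X) : nu < mu -> powO mu u ->
  bigO_pinfty u (fun t => t `^ (- nu)).
Proof.
move=> numu /(_ _ numu)[K [T [_ hT]]].
exists (Num.max 1 (T + 1)), (Num.max 1 K); split.
- by rewrite lt_max ltr01.
- by rewrite lt_max ltr01.
- move=> t; rewrite ge_max => /andP[_ Tt].
  rewrite (le_trans (enorm_le_nrm1 _))// (le_trans (hT _ _))//.
    by rewrite (lt_le_trans _ Tt)// ltrDl.
  by rewrite ler_wpM2r ?powR_ge0// le_max lexx orbT.
Qed.

Lemma powO_small (mu r : R) (u : R -> X) : 0 < mu -> 0 < r -> powO mu u ->
  \forall t \near +oo, nrm1 (u t) <= r.
Proof.
move=> mu0 r0 uO; pose nu := mu / 2.
have nu0 : 0 < nu by rewrite divr_gt0.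
have numu : nu < mu by rewrite ltr_pdivrMr// ltr_pMr// ltr1n.
have [K hK] := uO _ numu.
near=> t.
have t0 : 0 < t by near: t; apply: nbhs_pinfty_gt; exact: num_real.
have lnt : ln (Num.max 1 K / r) / nu < ln t by near: t; exact: iter_ln_gt 1 _.
have K0 : 0 < Num.max 1 K by rewrite lt_max ltr01.
apply: (@le_trans _ _ (K * t `^ (- nu))); first by near: t.
apply: (@le_trans _ _ (Num.max 1 K * t `^ (- nu))).
  by rewrite ler_wpM2r ?powR_ge0// le_max lexx orbT.
rewrite powRN ler_pdivrMr ?powR_gt0// mulrC -ler_pdivrMr// /powR gt_eqF//.
rewrite -[leLHS]lnK ?posrE ?divr_gt0// ler_expR.
by move: lnt; rewrite ltr_pdivrMr// [ln t * _]mulrC => /ltW.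
Unshelve. all: by end_near. Qed.

(** eps is fixed before the functions and the rate, so one eps serves the first bound on y and all
    partial sums. *)
Lemma decay_powO (A : 'M[C]_n) : (0 < n)%N ->
  (forall a : C, eigenvalue A a -> 0 < complex.Re a) ->
  exists eps : R, 0 < eps /\ forall (w g1 g2 : R -> X) (mu : R),
    (\forall t \near +oo, vderive w t (- (A *m w t) + (g1 t + g2 t))) ->
    (\forall t \near +oo, nrm1 (g1 t) <= eps * nrm1 (w t)) ->
    powO mu g2 -> powO mu w.
Proof.
move=> n0 specA; have [eps [e0 h]] := perturbed_linear_decay n0 specA.
exists eps; split=> // w g1 g2 mu dw hg1 g2O nu numu.
have [K hK] := g2O _ numu.
apply: (h w (fun t => g1 t + g2 t) nu K) => //.
apply: filterS2 hg1 hK => t h1 h2.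
by rewrite (le_trans (nrm1D _ _))// lerD.
Qed.

Section Group.
Variables (mu : nat -> R) (mu_incr : forall j k, (j < k)%N -> mu j < mu k).

(* Terms whose exponent is one of mu 0, ..., mu N cancel; the exponents of the
   others are at least mu N.+1, since all exponents lie in the range of mu. *)
Lemma powO_group (I : Type) (r : seq I) (P : pred I) (c : I -> R)
    (H : I -> R -> X) N :
  (forall i, P i -> range mu (c i)) -> (forall i, P i -> powO (c i) (H i)) ->
  powO (mu N.+1) (fun t => \sum_(i <- r | P i) H i t -
    \sum_(k < N.+1) \sum_(i <- r | P i && (c i == mu k)) H i t).
Proof.
move=> cmu HO.
apply: (@powO_eq _ _ _ (fun t => \sum_(i <- r | P i)
    (H i t - \sum_(k < N.+1 | c i == mu k) H i t))).
  apply: nearW => t; rewrite sumrB; congr (_ - _).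
  by rewrite (exchange_big_dep xpredT).
apply: powO_sum => i Pi; have [K _ cK] := cmu i Pi.
have [KN|NK] := leqP K N; last first.
  apply: (@powO_eq _ _ _ (H i)).
    apply: nearW => t; rewrite big_pred0 ?subr0// => k; apply/negbTE.
    rewrite -cK gt_eqF//; apply: mu_incr; exact: leq_trans (ltn_ord k) NK.
  apply: powOW (HO i Pi); rewrite -cK mu_leE//.
apply: (@powO_eq _ _ _ (fun=> 0)); last exact: powO0.
apply: nearW => t; rewrite (bigD1 (Ordinal (KN : (K < N.+1)%N))) -?cK//=.
rewrite big_pred0 ?addr0 ?subrr// => k; apply/negbTE.
apply/negP => /andP[/eqP h /negP]; apply.
by apply/eqP/val_inj => /=; apply/eqP; rewrite eqn_leq -!(mu_leE mu_incr) h lexx.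
Qed.

End Group.

(** * The nonlinearity near the origin *)

Section Nonlinearity.
Variables (calG : forall m, {ffun 'I_m -> X} -> X)
  (calG_lin : forall m, (2 <= m)%N -> multilinear (@calG m)).

Lemma nonlinear_small (M : nat) (eps : R) : 0 < eps ->
  exists r, 0 < r /\ forall x y : X, nrm1 x <= r -> nrm1 y <= r ->
    nrm1 (\sum_(2 <= m < M) (calG [ffun _ : 'I_m => x] - calG [ffun _ : 'I_m => y]))
      <= eps * nrm1 (x - y).
Proof.
elim: M eps => [|M IH] eps e0.
  exists 1; split=> // x y _ _.
  by rewrite big_geq// nrm1_0 mulr_ge0 ?nrm1_ge0// ltW.
have [M2|M2] := ltnP M 2.
  exists 1; split=> // x y _ _.
  by rewrite big_geq// nrm1_0 mulr_ge0 ?nrm1_ge0// ltW.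
have e2 : 0 < eps / 2 by rewrite divr_gt0.
have [r1 [r10 h1]] := IH _ e2.
have [r2 [r20 h2]] := multilinear_diag_small M2 (calG_lin M2) e2.
exists (Num.min r1 r2); rewrite lt_min r10 r20; split=> // x y.
rewrite !le_min => /andP[x1 x2] /andP[y1 y2].
rewrite big_nat_recr//= (le_trans (nrm1D _ _))//.
rewrite [eps]splitr mulrDl lerD ?h1 ?h2//.
Qed.

Variables (G : X -> X) (G_ : nat -> X -> X).
Hypothesis G_exp : expands_at0 G G_.
Hypothesis calGE : forall m, (2 <= m)%N ->
  forall x, G_ m x = calG [ffun _ : 'I_m => x].

Lemma sum_calGE M x : \sum_(2 <= m < M) G_ m x =
  \sum_(2 <= m < M) calG [ffun _ : 'I_m => x].
Proof. by apply: eq_big_nat => m /andP[m2 _]; exact: calGE. Qed.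

(** This serves the first bound on y, where only y -> 0 is known. Degree 2 suffices: the quadratic
    part is compared with its value at 0, and the remainder is of order |x|^(2+d). *)
Lemma G_small (eps : R) : (0 < n)%N -> 0 < eps -> exists r, 0 < r /\
  forall x : X, nrm1 x <= r -> nrm1 (G x) <= eps * nrm1 x.
Proof.
move=> n0 e0; have e2 : 0 < eps / 2 by rewrite divr_gt0.
have [d [d0 [r1 [K [r10 K0 hK]]]]] := G_exp (leqnn 2).
have [r2 [r20 h2]] := nonlinear_small 3 e2.
have nK : 0 < n%:R * K by rewrite mulr_gt0// ltr0n.
pose r := Num.min (Num.min (r1 / 2) r2) (Num.min 1 (eps / 2 / (n%:R * K))).
have r0 : 0 < r by rewrite !lt_min r20 ltr01 !divr_gt0.
exists r; split=> // x; rewrite !le_min => /andP[/andP[xr1 xr2] /andP[x1 xe]].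
have ex : enorm x <= nrm1 x := enorm_le_nrm1 x.
have h1 : nrm1 (G x - \sum_(2 <= m < 3) G_ m x) <= eps / 2 * nrm1 x.
  rewrite (le_trans (nrm1_le_enorm _))//.
  apply: (@le_trans _ _ (n%:R * (K * enorm x `^ (2%:R + d)))).
    rewrite ler_wpM2l// hK// (le_lt_trans ex)// (le_lt_trans xr1)//.
    by rewrite ltr_pdivrMr// ltr_pMr// ltr1n.
  have p2 : enorm x `^ (2%:R + d) <= nrm1 x * nrm1 x.
    have [->|ex0] := eqVneq (enorm x) 0.
      by rewrite powR0 ?mulr_ge0 ?nrm1_ge0// gt_eqF// ltr_wpDl.
    have ep : 0 < enorm x by rewrite lt_neqAle eq_sym ex0 enorm_ge0.
    apply: (@le_trans _ _ (enorm x `^ 2%:R)).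
      apply: ger_powR; first by rewrite ep (le_trans ex).
      by rewrite lerDl ltW.
    by rewrite powR_mulrn ?enorm_ge0// expr2 ler_pM ?enorm_ge0.
  rewrite mulrA (le_trans (ler_wpM2l (ltW nK) p2))// mulrA ler_wpM2r ?nrm1_ge0//.
  by rewrite mulrC -ler_pdivlMr.
have h3 : nrm1 (\sum_(2 <= m < 3) G_ m x) <= eps / 2 * nrm1 x.
  have := h2 x 0 xr2; rewrite nrm1_0 subr0 sumrB -sum_calGE.
  rewrite [X in _ - X]big_nat1.
  have -> : calG [ffun _ : 'I_2 => (0 : X)] = 0.
    rewrite -[in RHS](multilinear0 [ffun _ : 'I_2 => (0 : X)] ord0 (calG_lin (leqnn 2))).
    by congr calG; apply/ffunP => l; rewrite !ffunE; case: eqP.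
  by rewrite subr0; apply; exact: ltW.
rewrite -[G x](subrK (\sum_(2 <= m < 3) G_ m x)) (le_trans (nrm1D _ _))//.
by rewrite [eps]splitr mulrDl lerD.
Qed.

(* |y|^(M + d) = O(t^(-M mu0 / 2)) *)
Lemma G_remainder_powO (mu0 a : R) (M : nat) (y : R -> X) : (2 <= M)%N ->
  0 < mu0 -> 2 * a <= M%:R * mu0 -> powO mu0 y ->
  powO a (fun t => G (y t) - \sum_(2 <= m < M.+1) G_ m (y t)).
Proof.
move=> M2 mu00 aM yO; have [d [d0 [r [K [r0 K0 hK]]]]] := G_exp M2.
have r2 : 0 < r / 2 by rewrite divr_gt0.
have ys := powO_small mu00 r2 yO.
have m2 : mu0 / 2 < mu0 by rewrite ltr_pdivrMr// ltr_pMr// ltr1n.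
have [L hL] := yO _ m2.
move=> nu nua; pose L' := Num.max 1 L.
exists (n%:R * (K * L' `^ (M%:R + d))).
near=> t.
have t1 : 1 <= t by near: t; apply: nbhs_pinfty_ge; exact: num_real.
have t0 : 0 < t by rewrite (lt_le_trans ltr01).
rewrite (le_trans (nrm1_le_enorm _))// -mulrA ler_wpM2l//.
have yr : nrm1 (y t) <= r / 2 by near: t.
have yL : nrm1 (y t) <= L' * t `^ (- (mu0 / 2)).
  apply: (@le_trans _ _ (L * t `^ (- (mu0 / 2)))); first by near: t.
  by rewrite ler_wpM2r ?powR_ge0// le_max lexx orbT.
apply: (@le_trans _ _ (K * enorm (y t) `^ (M%:R + d))).
  apply: hK; rewrite (le_lt_trans (enorm_le_nrm1 _))// (le_lt_trans yr)//.
  by rewrite ltr_pdivrMr// ltr_pMr// ltr1n.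
rewrite -mulrA ler_wpM2l ?(ltW K0)//.
have L0 : 0 <= L' by rewrite le_max ler01.
have Md : 0 <= M%:R + d by rewrite addr_ge0// ltW.
apply: (@le_trans _ _ ((L' * t `^ (- (mu0 / 2))) `^ (M%:R + d))).
  apply: ge0_ler_powR; rewrite ?nnegrE ?enorm_ge0 ?mulr_ge0 ?powR_ge0//.
  exact: le_trans (enorm_le_nrm1 _) yL.
rewrite powRM ?powR_ge0// ler_wpM2l ?powR_ge0// -powRrM ler_powR//.
have : 0 <= mu0 * d by rewrite mulr_ge0 ?ltW.
by move: aM nua; lra.
Unshelve. all: by end_near. Qed.

End Nonlinearity.
End Remainders.

(** * The expansion *)

Section Residual.
Variables (R : realType) (n : nat).
Local Notation C := R[i].
Local Notation X := 'cV[C]_n.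
Variables (calG : forall m, {ffun 'I_m -> X} -> X)
  (calG_lin : forall m, (2 <= m)%N -> multilinear (@calG m))
  (mu : nat -> R) (mu_gt0 : forall k, 0 < mu k)
  (mu_incr : forall j k, (j < k)%N -> mu j < mu k)
  (mu_add : forall x y, range mu x -> range mu y -> range mu (x + y))
  (mu_add1 : forall x, range mu x -> range mu (x + 1))
  (nk : nat -> nat) (nk_incr : forall k, (nk k <= nk k.+1)%N).

Lemma widen_Lhat k k' (p : gfun X k) t : (k <= k')%N ->
  widen_gfun p (@Lhat R k' t) = p (@Lhat R k t).
Proof.
move=> kk'; rewrite /widen_gfun; congr p; apply/funext => j.
by rewrite /Lhat /= inordK// (leq_trans (ltn_ord j)).
Qed.

Lemma range_sum_mu m (j : 'I_m -> nat) : (0 < m)%N -> range mu (\sum_l mu (j l)).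
Proof.
elim: m j => [//|[|m] IH] j _; rewrite big_ord_recl.
  by rewrite big_ord0 addr0; exists (j ord0).
apply: mu_add; first by exists (j ord0).
exact: IH.
Qed.

Variables (q : forall k, gfun X (nk k)).
Hypothesis qP : forall k, scrP_m 0 (- mu k) (@q k).

Definition yterm (k : nat) (t : R) : X := @q k (@Lhat R (nk k) t).
Arguments yterm k t : clear implicits.

Lemma powO_yterm k : powO (mu k) (yterm k).
Proof. exact: scrP_powO. Qed.

Lemma powO_partial_sum N : powO (mu 0) (fun t => \sum_(k < N) yterm k t).
Proof.
apply: powO_sum => k _; apply: (@powOW _ _ (mu k)); first by rewrite mu_leE.
exact: powO_yterm.
Qed.

(** The arguments involve different numbers of logarithms and are first widened to the common depth
    [nk N]. *)
Lemma powO_calG m N (j : {ffun 'I_m -> 'I_N}) : (2 <= m)%N ->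
  powO (\sum_l mu (j l)) (fun t => calG [ffun l => yterm (j l) t]).
Proof.
move=> m2.
have /scrP_powO h : scrP_m 0 (- \sum_l mu (j l)) ((fun z : 'I_(nk N).+2 -> R =>
    calG [ffun l => widen_gfun (@q (j l)) z]) : gfun X (nk N)).
  rewrite -sumrN; apply: scrP_multilinear; first exact: calG_lin.
  by move=> l; apply: scrP_widen => //; apply: nk_mono => //; exact: ltnW.
apply: powO_eq h; apply: nearW => t; congr calG; apply/ffunP => l.
by rewrite !ffunE widen_Lhat//; apply: nk_mono => //; exact: ltnW.
Qed.

Lemma Gterm_Lhat k N M t : (k <= N)%N -> mu k <= M%:R * mu 0 ->
  Gterm calG mu q k (@Lhat R (nk k) t) = \sum_(2 <= m < M.+1)
    \sum_(j : {ffun 'I_m -> 'I_N} | \sum_l mu (j l) == mu k)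
      calG [ffun l => yterm (j l) t].
Proof.
move=> kN kM; rewrite (Gterm_finite calG mu_gt0 mu_incr _ _ kN kM).
apply: eq_big_nat => m /andP[m2 _]; apply: eq_bigr => j /eqP jk.
congr calG; apply/ffunP => l; rewrite !ffunE widen_Lhat//.
by apply: nk_mono => //; rewrite ltnW// (exponent_index_lt mu_gt0 mu_incr l m2 jk).
Qed.

(** At most one l satisfies the condition, as mu is injective; writing the choice as a sum gives it
    the shape required by [powO_group]. *)
Lemma chi_Lhat k N t : (k <= N)%N ->
  chi mu q k (@Lhat R (nk k) t) =
  \sum_(l < N | mu l + 1 == mu k) opR (@q l) (@Lhat R (nk l) t).
Proof.
move=> kN.
have ltk l : mu l + 1 == mu k -> (l < k)%N.
  by move=> /eqP h; rewrite -(mu_ltE mu_incr) -h ltrDl.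
rewrite /chi; case: pickP => [l lk|h].
  rewrite widen_Lhat; last by apply: nk_mono => //; exact: ltnW.
  rewrite (bigD1 (widen_ord kN l))//= big_pred0 ?addr0// => i.
  apply/negP => /andP[/eqP ik /negP]; apply; apply/eqP/val_inj => /=.
  apply/eqP; rewrite eqn_leq -!(mu_leE mu_incr).
  have -> : mu i = mu l by apply: (addIr 1); rewrite ik (eqP lk).
  by rewrite lexx.
rewrite big_pred0// => l; apply/negP => lk.
by have := h (Ordinal (ltk _ lk)); rewrite /= lk.
Qed.

(** Expanded over index tuples, the nonlinear terms at s are grouped by exponent sum: [Gterm k] is
    the group of exponent [mu k]. *)
Lemma powO_nonlinear_residual N M : mu N.+1 <= M%:R * mu 0 ->
  powO (mu N.+1) (fun t =>
    \sum_(2 <= m < M.+1) calG [ffun _ : 'I_m => \sum_(k < N.+1) yterm k t] -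
    \sum_(k < N.+1) Gterm calG mu q k (@Lhat R (nk k) t)).
Proof.
move=> NM.
have E t : \sum_(k < N.+1) Gterm calG mu q k (@Lhat R (nk k) t) =
    \sum_(2 <= m < M.+1) \sum_(k < N.+1)
      \sum_(j : {ffun 'I_m -> 'I_N.+1} | \sum_l mu (j l) == mu k)
        calG [ffun l => yterm (j l) t].
  rewrite exchange_big/=; apply: eq_bigr => k _; apply: Gterm_Lhat.
    exact: ltnW.
  by rewrite (le_trans _ NM)// mu_leE// ltnW.
apply: (@powO_eq _ _ _ (fun t => \sum_(2 <= m < M.+1 | (2 <= m < M.+1)%N)
  (\sum_(j : {ffun 'I_m -> 'I_N.+1}) calG [ffun l => yterm (j l) t] -
   \sum_(k < N.+1) \sum_(j : {ffun 'I_m -> 'I_N.+1} | \sum_l mu (j l) == mu k)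
     calG [ffun l => yterm (j l) t]))).
  apply: nearW => t; rewrite E -sumrB [RHS]big_nat_cond.
  apply: eq_big => [m|m /andP[m2 _]]; first by rewrite andbT.
  by rewrite multilinear_diag_sum//; exact: calG_lin.
apply: powO_sum => m /andP[m2 _].
apply: powO_group => // j _; first by apply: range_sum_mu; exact: ltnW.
exact: powO_calG.
Qed.

Lemma powO_derivative_residual N : powO (mu N.+1) (fun t =>
    \sum_(k < N.+1) opR (@q k) (@Lhat R (nk k) t) -
    \sum_(k < N.+1) chi mu q k (@Lhat R (nk k) t)).
Proof.
apply: (@powO_eq _ _ _ (fun t =>
    \sum_(l < N.+1) opR (@q l) (@Lhat R (nk l) t) -
    \sum_(k < N.+1) \sum_(l < N.+1 | true && (mu l + 1 == mu k))
       opR (@q l) (@Lhat R (nk l) t))).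
  apply: nearW => t; congr (_ - _); apply: eq_bigr => k _.
  by rewrite (chi_Lhat (N := N.+1))//; exact: ltnW.
apply: (@powO_group _ _ _ mu_incr _ _ _ (fun l : 'I_N.+1 => mu l + 1)) => // l _.
  by apply: mu_add1; exists l.
by apply: scrP_powO; rewrite opprD; exact: scrP_opR.
Qed.

Variables (A : 'M[C]_n) (p : forall k, gfun X (nk k)).
Hypothesis A_spec : forall a : C, eigenvalue A a -> 0 < complex.Re a.
Hypothesis pP : forall k, scrP_m 0 (- mu k) (@p k).
Hypothesis qE : forall k, @q k = coef_step calG mu A p q k.

Definition dyterm (k : nat) (t : R) : X :=
  opM ord0 (@q k) (@Lhat R (nk k) t) + opR (@q k) (@Lhat R (nk k) t).
Arguments dyterm k t : clear implicits.

Lemma yterm_equation k : \forall t \near +oo,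
  A *m yterm k t + dyterm k t = Gterm calG mu q k (@Lhat R (nk k) t) +
    @p k (@Lhat R (nk k) t) - chi mu q k (@Lhat R (nk k) t) +
    opR (@q k) (@Lhat R (nk k) t).
Proof.
have := orthant_Lhat R (nk k); apply: filterS => t tk.
rewrite /dyterm addrA; congr (_ + _).
have rhsP : scrP_m 0 (- mu k)
    (fun z => Gterm calG mu q k z + @p k z - chi mu q k z).
  by apply: scrP_rhs.
rewrite -[RHS](opZK A_spec rhsP tk) -/(coef_step calG mu A p q k) -qE.
by [].
Qed.

Lemma powO_residual N M : mu N.+1 <= M%:R * mu 0 -> powO (mu N.+1) (fun t =>
  \sum_(2 <= m < M.+1) calG [ffun _ : 'I_m => \sum_(k < N.+1) yterm k t] +
  \sum_(k < N.+1) @p k (@Lhat R (nk k) t) -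
  (A *m \sum_(k < N.+1) yterm k t + \sum_(k < N.+1) dyterm k t)).
Proof.
move=> NM.
apply: powO_eq (powOD (powO_nonlinear_residual NM)
  (powON (@powO_derivative_residual N))).
have : \forall t \near +oo, forall k : 'I_N.+1, A *m yterm k t + dyterm k t =
    Gterm calG mu q k (@Lhat R (nk k) t) +
    @p k (@Lhat R (nk k) t) - chi mu q k (@Lhat R (nk k) t) +
    opR (@q k) (@Lhat R (nk k) t).
  by apply: filter_forall => k; exact: yterm_equation.
apply: filterS => t h.
rewrite mulmx_sumr -big_split/= (eq_bigr _ (fun k _ => h k)).
rewrite 2!big_split/= sumrN big_split/=.
set a := \sum_(2 <= m < M.+1) _; set g := \sum_(k < N.+1) Gterm _ _ _ _ _.
set b := \sum_(k < N.+1) p _; set c := \sum_(k < N.+1) chi _ _ _ _.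
set d := \sum_(k < N.+1) opR _ _.
apply/eqP; rewrite -subr_eq0; apply/eqP.
by apply/colP => i; rewrite !mxE; ring.
Qed.

End Residual.

Arguments yterm {R n nk} q k t.
Arguments dyterm {R n nk} q k t.

Theorem theorem8p3 (R : realType) (n : nat) (n_gt0 : (0 < n)%N)
  (A : 'M[R[i]]_n)
  (A_spec : forall a : R[i], eigenvalue A a -> 0 < complex.Re a)
  (G : 'cV[R[i]]_n -> 'cV[R[i]]_n)
  (G_lip : locally_lipschitz G)
  (G_ : nat -> 'cV[R[i]]_n -> 'cV[R[i]]_n)
  (G_hom : forall m, (2 <= m)%N -> homogeneous_polynomial m (G_ m))
  (G_exp : expands_at0 G G_)
  (calG : forall m, {ffun 'I_m -> 'cV[R[i]]_n} -> 'cV[R[i]]_n)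
  (calG_lin : forall m, (2 <= m)%N -> multilinear (@calG m))
  (calGE : forall m, (2 <= m)%N -> forall x, G_ m x = calG m [ffun=> x])
  (f : R -> 'cV[R[i]]_n) (Tf : R) (Tf_ge0 : 0 <= Tf)
  (f_cont : econtinuous_on [set t | Tf <= t] f)
  (mu : nat -> R)
  (mu_gt0 : forall k, 0 < mu k)
  (mu_incr : forall j k, (j < k)%N -> mu j < mu k)
  (mu_div : mu k @[k --> \oo] --> +oo)
  (mu_add : forall x y, range mu x -> range mu y -> range mu (x + y))
  (mu_add1 : forall x, range mu x -> range mu (x + 1))
  (nk : nat -> nat)
  (nk_incr : forall k, (nk k <= nk k.+1)%N)
  (f_ : nat -> R -> 'cV[R[i]]_n)
  (f_exp : power_expansion f nk mu f_)
  (T0 : R) (T0_ge0 : 0 <= T0)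
  (y : R -> 'cV[R[i]]_n)
  (y_C1 : C1_on [set t | T0 < t] y)
  (y_ode : forall t, T0 < t ->
     is_ederive y t (- (A *m y t) + G (y t) + f t))
  (y_lim : ecvg +oo y 0) :
  (exists y_ : nat -> R -> 'cV[R[i]]_n, power_expansion y nk mu y_) /\
  (forall p : forall k, gfun 'cV[R[i]]_n (nk k),
     (forall k, scrP_m 0 (- mu k) (p k) /\
        forall t, iterexp (nk k) 0 < t -> f_ k t = p k (@Lhat R (nk k) t)) ->
   exists (y_ : nat -> R -> 'cV[R[i]]_n)
          (q : forall k, gfun 'cV[R[i]]_n (nk k)),
   [/\ power_expansion y nk mu y_,
       forall k, scrP_m 0 (- mu k) (q k) /\
         forall t, iterexp (nk k) 0 < t -> y_ k t = q k (@Lhat R (nk k) t)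
     & forall k z, orthant z ->
         q k z = opZ A (fun z' =>
           Gterm calG mu q k z' + p k z' - chi mu q k z') z]).
Proof.
(* The first claim follows from the second, applied to the p_k that the expansion of f provides. *)
have and_from_right (P Q : Prop) : (Q -> P) -> Q -> P /\ Q by split; auto.
apply: and_from_right => [main|p hp].
  have [y_ [q [? _ _]]] := main (fun k => projT1 (cid (f_exp.1 k)))
    (fun k => projT2 (cid (f_exp.1 k))).
  by exists y_.
have pP k : scrP_m 0 (- mu k) (p k) by exact: (hp k).1.
have [q qE] := exists_coefficients calG mu_gt0 mu_incr A p.
have qP := scrP_coefficients calG_lin mu_gt0 mu_incr nk_incr pP qE.
pose y_ := yterm q.
have [eps [eps0 decay]] := decay_powO n_gt0 A_spec.
have fp k : \forall t \near +oo, f_ k t = p k (@Lhat R (nk k) t).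
  near=> t; apply: (hp k).2; near: t.
  by apply: nbhs_pinfty_gt; exact: num_real.
have fO k : powO (mu k) (f_ k).
  apply: powO_eq (scrP_powO (pP k)).
  by have := fp k; apply: filterS => t ->.
(* The expansion with N + 1 terms only promises some rate above [mu N]. Using it one index later and
   moving the last term back gives the full rate of the first omitted term. *)
have fR N : powO (mu N) (fun t => f t - \sum_(k < N) f_ k t).
  have [nu [Nnu hnu]] := f_exp.2 N.
  apply: powO_eq (powOD (bigO_powO (ltW Nnu) hnu) (fO N)).
  by apply: nearW => t; rewrite big_ord_recr/= opprD addrA subrK.
have dy : \forall t \near +oo, vderive y t (- (A *m y t) + G (y t) + f t).
  near=> t; apply: ederive_vderive; apply: y_ode.
  by near: t; apply: nbhs_pinfty_gt; exact: num_real.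
have ysmall r : 0 < r -> \forall t \near +oo, nrm1 (y t) <= r.
  move=> r0; have rn : 0 < r / n%:R by rewrite divr_gt0// ltr0n.
  have /cvgrPdist_lt/(_ _ rn) := y_lim; apply: filterS => t.
  rewrite sub0r normrN subr0 ger0_norm ?enorm_ge0// => /ltW h.
  rewrite (le_trans (nrm1_le_enorm _))// mulrC -ler_pdivlMr ?ltr0n//.
(* The decay lemma for the empty partial sum: G(y) is the small perturbation and f the forcing. *)
have yO : powO (mu 0) y.
  have [r [r0 hr]] := G_small calG_lin G_exp calGE n_gt0 eps0.
  apply: (decay y (fun t => G (y t)) f).
  - by apply: filterS dy => t; rewrite addrA.
  - by have := ysmall r r0; apply: filterS => t; exact: hr.
  - by apply: powO_eq (fR 0%N); apply: nearW => t; rewrite big_ord0 subr0.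
have yR N : powO (mu N.+1) (fun t => y t - \sum_(k < N.+1) y_ k t).
  (* The factor 2 pays for [G_remainder_powO], which uses y only at the rate [mu 0] / 2. *)
  have [M [M2 NM]] := exists_multiple mu_gt0 (2 * mu N.+1).
  have NM1 : mu N.+1 <= M%:R * mu 0%N.
    by rewrite (le_trans _ NM)// ler_peMl ?(ltW (mu_gt0 _))// ler1n.
  pose s t := \sum_(k < N.+1) y_ k t.
  pose g1 t := \sum_(2 <= m < M.+1) (calG m [ffun=> y t] - calG m [ffun=> s t]).
  pose res t := \sum_(2 <= m < M.+1) calG m [ffun=> s t] +
    \sum_(k < N.+1) p k (@Lhat R (nk k) t) -
    (A *m s t + \sum_(k < N.+1) dyterm q k t).
  (* The three errors are the defect of the partial sum in the truncated equation, the tail of f,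
     and the remainder of G at y. *)
  pose g2 t := res t + (f t - \sum_(k < N.+1) p k (@Lhat R (nk k) t)) +
    (G (y t) - \sum_(2 <= m < M.+1) G_ m (y t)).
  apply: (decay _ g1 g2).
  - have ds : \forall t \near +oo, forall k : 'I_N.+1,
        vderive (y_ k) t (dyterm q k t).
      by apply: filter_forall => k; exact: vderive_scrP (qP k).
    apply: filterS2 dy ds => t dyt dst.
    have := vderiveD dyt (vderiveN (vderive_sum (index_enum 'I_N.+1) (P := predT)
      (fun k _ => dst k))).
    congr vderive; rewrite /g1 /g2 /res sumrB -(sum_calGE calGE) mulmxBr.
    rewrite -/(s t).
    set a := \sum_(2 <= m < M.+1) _; set b := \sum_(2 <= m < M.+1) _.
    set c := \sum_(k < N.+1) p k _; set d := \sum_(k < N.+1) dyterm q k t.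
    by apply/colP => i; rewrite !mxE; ring.
  - have [r [r0 hr]] := nonlinear_small calG_lin M.+1 eps0.
    have ss := powO_small (mu_gt0 0%N) r0 (powO_partial_sum mu_incr qP N.+1).
    have ys := ysmall r r0.
    by apply: filterS2 ys ss => t; exact: hr.
  - apply: powOD; last exact: (G_remainder_powO G_exp M2 (mu_gt0 0%N) NM yO).
    apply: powOD; first exact: powO_residual.
    apply: powO_eq (fR N.+1).
    have : \forall t \near +oo, forall k : 'I_N.+1,
        f_ k t = p k (@Lhat R (nk k) t) by apply: filter_forall => k; exact: fp.
    apply: filterS => t h; congr (_ - _); apply: eq_bigr => k _; exact: h.
exists y_, q; split=> //.
- split=> [k|N].
    by exists (q k); split.
  (* The midpoint exceeds [mu N], as the expansion demands, and stays below [mu N.+1], as [powO]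
     demands. *)
  exists ((mu N + mu N.+1) / 2); have := mu_incr N N.+1 (ltnSn N) => h.
  split; first by rewrite ltr_pdivlMr//; lra.
  apply: powO_bigO (yR N); rewrite ltr_pdivrMr//; lra.
- by move=> k z _; rewrite {1}qE.
Unshelve. all: by end_near. Qed.
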